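(* Let $w$ be a weight function on $[0,\infty)$, let $A:=L_0^\infty(w)^*$ be equipped with the first Arens product, and let $\theta:A\to A$ be a homomorphism. Then: (i) If $D_1,D_2:A\to A$ are $\theta$-derivations on $A$, then their product (composition) $D_1D_2$ is a $\theta$-derivation on $\mathrm{ran}(A)$; that is, $D_1D_2$ maps $\mathrm{ran}(A)$ into $\mathrm{ran}(A)$ and $D_1D_2(mn)=D_1D_2(m)\theta(n)+\theta(m)D_1D_2(n)$ for all $m,n\in\mathrm{ran}(A)$. (ii) Every $\theta$-derivation on $\mathrm{ran}(A)$ is spectrally bounded.
   Context: A weight function is a continuous function $w:[0,\infty)\to[1,\infty)$ with $w(0)=1$ and $w(x+y)\le w(x)w(y)$ for all $x,y\ge 0$. $L^1(w)$ is the Banach space of (classes of) complex Lebesgue measurable functions $\varphi$ on $[0,\infty)$ with $\|\varphi\|_w=\int_0^\infty w(x)|\varphi(x)|\,dx<\infty$. $L_0^\infty(w)$ is the Banach space of (classes of) complex Lebesgue measurable functions $f$ on $[0,\infty)$ such that $f/w$ is essentially bounded and $\lim_{x\to\infty}\operatorname{ess\,sup}_{y>x}|f(y)|/w(y)=0$, with norm $\operatorname{ess\,sup}|f|/w$. For $f\in L_0^\infty(w)$ and $\varphi\in L^1(w)$ let $(f\varphi)(x)=\int_0^\infty f(x+y)\varphi(y)\,dy$ for $x\ge 0$, which defines an element of $L_0^\infty(w)$. For $n\in L_0^\infty(w)^*$ and $f\in L_0^\infty(w)$, $nf\in L_0^\infty(w)$ is the element determined by $\int_0^\infty (nf)(x)\varphi(x)\,dx=\langle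 n,f\varphi\rangle$ for all $\varphi\in L^1(w)$. The dual $A=L_0^\infty(w)^*$ is a Banach algebra under the first Arens product $\langle mn,f\rangle=\langle m,nf\rangle$. $\mathrm{ran}(A)=\{r\in A: ar=0\text{ for all }a\in A\}$ is the right annihilator. A homomorphism is a linear multiplicative map $A\to A$. Given a homomorphism $\theta$ on $A$, a $\theta$-derivation on $A$ is a linear map $D:A\to A$ (no continuity assumed) with $D(mn)=D(m)\theta(n)+\theta(m)D(n)$ for all $m,n\in A$; a $\theta$-derivation on $\mathrm{ran}(A)$ is a linear map $D:\mathrm{ran}(A)\to\mathrm{ran}(A)$ satisfying the same identity for all $m,n\in\mathrm{ran}(A)$. A map $T$ is spectrally bounded if there is $c\ge 0$ such that $r(T(m))\le c\,r(m)$ for all $m$ in its domain, where $r(m)=\lim_{n}\|m^n\|^{1/n}$ is the spectral radius of $m$ in $A$. *)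

(* Defs.v *)
From HB Require Import structures.
From mathcomp Require Import all_boot all_order all_algebra.
From mathcomp Require Import all_classical all_reals all_analysis.
From mathcomp Require Import measurable_realfun ess_sup_inf complex.

Set Implicit Arguments.
Unset Strict Implicit.
Unset Printing Implicit Defensive.

Import Order.TTheory GRing.Theory Num.Theory.
Import numFieldNormedType.Exports.
Import ComplexField.Normc.

Local Open Scope classical_set_scope.
Local Open Scope quotient_scope.
Local Open Scope complex_scope.
Local Open Scope ring_scope.

(* Measurable means Borel measurable: every Lebesgue measurable function is
   a.e. equal to a Borel one, so the spaces of classes are the same.
   A class of functions on [0, +oo[ is represented by functions on the whole
   line whose values on the negative reals are ignored everywhere below. *)

Record weight (R : realType) := Weight {
  weight_fun :> R -> R;
  weight_continuous : {within `[0, +oo[, continuous weight_fun};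
  weight_ge1 : forall x, 0 <= x -> 1 <= weight_fun x;
  weight_at0 : weight_fun 0 = 1;
  weight_submult : forall x y, 0 <= x -> 0 <= y ->
    weight_fun (x + y) <= weight_fun x * weight_fun y
}.

Section complex_functions.
Context {R : realType}.
Implicit Types (f g : R -> R[i]) (I : interval R).

Definition cmeasurable (D : set R) f :=
  measurable_fun D (fun x => complex.Re (f x)) /\
  measurable_fun D (fun x => complex.Im (f x)).

Definition cintegral (D : set R) f : R[i] :=
  Rintegral lebesgue_measure D (fun x => complex.Re (f x)) +i*
  Rintegral lebesgue_measure D (fun x => complex.Im (f x)).

Definition ess_sup_itv I (h : R -> R) : \bar R :=
  ess_sup (mrestr lebesgue_measure (measurable_itv I)) (EFin \o h).

End complex_functions.

Section weighted_spaces.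
Context {R : realType} (w : weight R).
Implicit Types f g phi : R -> R[i].

Definition in_L1 phi :=
  cmeasurable `[0, +oo[ phi /\
  (\int[lebesgue_measure]_(x in `[0%R, +oo[) (w x * normc (phi x))%:E < +oo)%E.

Definition wratio f (x : R) : R := normc (f x) / w x.

Definition in_L0inf f :=
  [/\ cmeasurable `[0, +oo[ f,
      (ess_sup_itv `[0%R, +oo[ (wratio f) < +oo)%E &
      ess_sup_itv `]x, +oo[ (wratio f) @[x --> +oo] --> 0%E].

Definition L0inf_pred : {pred R -> R[i]} := fun f => `[< in_L0inf f >].

Local Lemma normcD (x y : R[i]) : normc (x + y) <= normc x + normc y.
Proof. by rewrite -lecR rmorphD; exact: (ler_normD x y). Qed.

Local Lemma cmeasurable_lin (D : set R) (a : R[i]) f g :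
  cmeasurable D f -> cmeasurable D g -> cmeasurable D (a *: f + g).
Proof.
move=> [fr fi] [gr gi]; split.
  rewrite (_ : (fun x => _) = (fun x =>
    (complex.Re a * complex.Re (f x) - complex.Im a * complex.Im (f x))
      + complex.Re (g x))); last first.
    by apply/funext => x; rewrite /= !fctE/=;
      case: a (f x) (g x) => ? ? [? ?] [? ?].
  apply: measurable_funD => //.
  by apply: measurable_funB; apply: measurable_funM.
rewrite (_ : (fun x => _) = (fun x =>
    (complex.Re a * complex.Im (f x) + complex.Im a * complex.Re (f x))
      + complex.Im (g x))); last first.
  by apply/funext => x; rewrite /= !fctE/=;
      case: a (f x) (g x) => ? ? [? ?] [? ?].
apply: measurable_funD => //.
by apply: measurable_funD; apply: measurable_funM.
Qed.

Local Lemma ae_itv I (P : R -> Prop) : (forall x, x \in I -> P x) ->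
  \forall x \ae mrestr lebesgue_measure (measurable_itv I), P x.
Proof.
move=> IP; exists (~` [set` I]); split; first exact: measurableC.
  by rewrite /mrestr setICl measure0.
by move=> x /= nP Ix; apply: nP; exact: IP.
Qed.

Local Lemma halfline_gt0 (b : bool) (x : R) :
  (0 < mrestr lebesgue_measure
         (measurable_itv (Interval (BSide b x) +oo%O)) setT)%E.
Proof. by rewrite /mrestr setTI lebesgue_measure_itv/= ltry addye. Qed.

Local Lemma ess_sup_wratio_ge0 b (x : R) f : 0 <= x ->
  (0 <= ess_sup_itv (Interval (BSide b x) +oo%O) (wratio f))%E.
Proof.
move=> x0; apply: ess_sup_gee; first exact: halfline_gt0.
apply: ae_itv => y; rewrite in_itv/= andbT => xy.
have y0 : 0 <= y by case: b xy => [|/ltW]; exact: le_trans.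
rewrite lee_fin divr_ge0//; last exact: le_trans (weight_ge1 w y0).
by case: (f y) => ? ?; rewrite sqrtr_ge0.
Qed.

Local Lemma ess_sup_wratio_lin b (x : R) (a : R[i]) f g I : 0 <= x ->
  I = Interval (BSide b x) +oo%O ->
  (ess_sup_itv I (wratio (a *: f + g)%R) <=
   (normc a)%:E * ess_sup_itv I (wratio f) + ess_sup_itv I (wratio g))%E.
Proof.
move=> x0 ->.
have a0 : 0 <= normc a by case: a => ? ?; rewrite sqrtr_ge0.
rewrite /ess_sup_itv -(ess_suprZl _ (halfline_gt0 b x))//.
apply: le_trans (ess_suprD _ _ _); apply: le_ess_sup.
apply: ae_itv => y; rewrite in_itv/= andbT => xy.
have y0 : 0 <= y by case: b xy => [|/ltW]; exact: le_trans.
rewrite lee_fin /wratio mulrA -mulrDl ler_wpM2r//.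
  by rewrite invr_ge0; exact: le_trans (weight_ge1 w y0).
by rewrite -normcM; exact: normcD.
Qed.

Local Lemma wratio0 b (x : R) :
  ess_sup_itv (Interval (BSide b x) +oo%O) (wratio 0) = 0%E.
Proof.
rewrite /ess_sup_itv (_ : EFin \o wratio 0 = cst 0%E).
  by apply: ess_sup_cst; exact: halfline_gt0.
by apply/funext => y /=; rewrite /wratio normc0 mul0r.
Qed.

Lemma L0inf_pred_submod_closed : submod_closed L0inf_pred.
Proof.
split=> [|a f g /asboolP[mf bf lf] /asboolP[mg bg lg]]; apply/asboolP; split.
- by split; exact: measurable_cst.
- by rewrite wratio0.
- rewrite (_ : (fun x => _) = cst 0%E); first exact: cvg_cst.
  by apply/funext => x; exact: wratio0.
- exact: cmeasurable_lin.
- apply: (le_lt_trans (ess_sup_wratio_lin _ _ _ (lexx _) erefl)).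
  by apply: lte_add_pinfty => //; apply: lte_mul_pinfty => //;
    rewrite lee_fin; case: (a) => ? ?; rewrite sqrtr_ge0.
apply: (@squeeze_cvge _ _ _ _ (cst 0%E) _ (fun x =>
  (normc a)%:E * ess_sup_itv `]x, +oo[ (wratio f)
    + ess_sup_itv `]x, +oo[ (wratio g))%E).
- near=> x; have x0 : 0 <= x by near: x; exact: nbhs_pinfty_ge.
  by rewrite ess_sup_wratio_ge0//= (ess_sup_wratio_lin _ _ _ x0 erefl).
- exact: cvg_cst.
rewrite -[X in _ --> X]adde0 -[X in _ --> (X + _)%E](mule0 (normc a)%:E).
by apply: cvgeD => //; exact: cvgeZl.
Unshelve. all: by end_near. Qed.

HB.instance Definition _ :=
  GRing.isSubmodClosed.Build R[i] (R -> R[i]) L0inf_pred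
    L0inf_pred_submod_closed.

Record L0inf_fun := L0infFun {
  L0inf_val :> R -> R[i];
  _ : L0inf_val \in L0inf_pred
}.

HB.instance Definition _ := [isSub for L0inf_val].
HB.instance Definition _ := gen_eqMixin L0inf_fun.
HB.instance Definition _ := gen_choiceMixin L0inf_fun.
HB.instance Definition _ := [SubChoice_isSubLmodule of L0inf_fun by <:].

Definition ae_eqb (f g : L0inf_fun) : bool :=
  `[< \forall x \ae @lebesgue_measure R, 0 <= x -> f x = g x >].

#[local] Instance lebesgue_ae_filter :
  Filter (nbhs (almost_everywhere (@lebesgue_measure R))).
Proof. by apply: ae_filter_ringOfSetsType. Qed.

Let ae_eqb_refl : reflexive ae_eqb.
Proof. by move=> f; apply/asboolP; exact: aeW. Qed.

Let ae_eqb_sym : symmetric ae_eqb.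
Proof.
move=> f g; apply/idP/idP => /asboolP h; apply/asboolP.
  by near=> x => x0; rewrite (near h x _).
by near=> x => x0; rewrite (near h x _).
Unshelve. all: by end_near. Qed.

Let ae_eqb_trans : transitive ae_eqb.
Proof.
move=> f g h /asboolP gf /asboolP fh; apply/asboolP.
by near=> x => x0; rewrite (near gf x _)// (near fh x _).
Unshelve. all: by end_near.
Qed.

Canonical ae_eqb_equiv := EquivRel ae_eqb ae_eqb_refl ae_eqb_sym ae_eqb_trans.

Definition L0inf : Type := {eq_quot ae_eqb}.
HB.instance Definition _ := Choice.on L0inf.
HB.instance Definition _ := EqQuotient.on L0inf.

Definition L0inf_add (F G : L0inf) : L0inf := \pi_L0inf (repr F + repr G).
Definition L0inf_opp (F : L0inf) : L0inf := \pi_L0inf (- repr F).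
Definition L0inf_scale (a : R[i]) (F : L0inf) : L0inf := \pi_L0inf (a *: repr F).

Local Lemma repr_ae (f : L0inf_fun) :
  \forall x \ae @lebesgue_measure R, 0 <= x -> repr (\pi_L0inf f) x = f x.
Proof.
have /asboolP//: ae_eqb (repr (\pi_L0inf f)) f.
by apply/(@eqquotP _ ae_eqb L0inf); rewrite reprK.
Qed.

Local Lemma L0inf_pi_add (f g : L0inf_fun) :
  L0inf_add (\pi_L0inf f) (\pi_L0inf g) = \pi_L0inf (f + g).
Proof.
apply/(@eqquotP _ ae_eqb L0inf)/asboolP; near=> x => x0.
by rewrite /= !fctE (near (repr_ae f) x _)// (near (repr_ae g) x _).
Unshelve. all: by end_near.
Qed.

Local Lemma L0inf_pi_opp (f : L0inf_fun) :
  L0inf_opp (\pi_L0inf f) = \pi_L0inf (- f).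
Proof.
apply/(@eqquotP _ ae_eqb L0inf)/asboolP.
by apply: filterS (repr_ae f) => x hf x0; rewrite /= !fctE hf.
Qed.

Local Lemma L0inf_pi_scale a (f : L0inf_fun) :
  L0inf_scale a (\pi_L0inf f) = \pi_L0inf (a *: f).
Proof.
apply/(@eqquotP _ ae_eqb L0inf)/asboolP.
by apply: filterS (repr_ae f) => x hf x0; rewrite /= !fctE hf.
Qed.

Let L0inf_addA : associative L0inf_add.
Proof.
elim/quotW => f; elim/quotW => g; elim/quotW => h.
by rewrite (L0inf_pi_add g h) (L0inf_pi_add f g) !L0inf_pi_add addrA.
Qed.

Let L0inf_addC : commutative L0inf_add.
Proof. by move=> F G; rewrite /L0inf_add addrC. Qed.

Let L0inf_add0 : left_id (\pi_L0inf 0) L0inf_add.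
Proof. by elim/quotW => f; rewrite L0inf_pi_add add0r. Qed.

Let L0inf_addN : left_inverse (\pi_L0inf 0) L0inf_opp L0inf_add.
Proof. by elim/quotW => f; rewrite (L0inf_pi_opp f) L0inf_pi_add addNr. Qed.

HB.instance Definition _ :=
  GRing.isZmodule.Build L0inf L0inf_addA L0inf_addC L0inf_add0 L0inf_addN.

Let L0inf_scaleA a b F :
  L0inf_scale a (L0inf_scale b F) = L0inf_scale (a * b) F.
Proof.
by elim/quotW: F => f; rewrite (L0inf_pi_scale b f) !L0inf_pi_scale scalerA.
Qed.

Let L0inf_scale1 : left_id 1 L0inf_scale.
Proof. by elim/quotW => f; rewrite L0inf_pi_scale scale1r. Qed.

Let L0inf_scaleDr : right_distributive L0inf_scale +%R.
Proof.
move=> a; elim/quotW => f; elim/quotW => g.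
rewrite [X in L0inf_scale a X]L0inf_pi_add !L0inf_pi_scale scalerDr.
exact/esym/L0inf_pi_add.
Qed.

Let L0inf_scaleDl F : {morph L0inf_scale^~ F : a b / a + b}.
Proof.
move=> a b; elim/quotW: F => f; rewrite !L0inf_pi_scale scalerDl.
exact/esym/L0inf_pi_add.
Qed.

HB.instance Definition _ := GRing.Zmodule_isLmodule.Build R[i] L0inf
  L0inf_scaleA L0inf_scale1 L0inf_scaleDr L0inf_scaleDl.

Definition L0inf_norm (F : L0inf) : R :=
  fine (ess_sup_itv `[0, +oo[ (wratio (repr F))).

(* class of f; the default 0 is used only if f is not in L_0^oo(w), which never
   happens for the functions translate_integral f phi below *)
Definition L0inf_class f : L0inf := \pi_L0inf (insubd (0 : L0inf_fun) f).

(* the function written f phi for f in L_0^oo(w) and phi in L^1(w) *)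
Definition translate_integral f phi : R -> R[i] :=
  fun x => cintegral `[0, +oo[ (fun y => f (x + y) * phi y).

Definition dual_pred : {pred L0inf -> R[i]^o} := fun n =>
  `[< linear n /\
      exists c : R, forall F : L0inf, normc (n F) <= c * L0inf_norm F >].

Lemma dual_pred_submod_closed : submod_closed dual_pred.
Proof.
split=> [|a m n /asboolP[lm [c mc]] /asboolP[ln [d nd]]]; apply/asboolP; split.
- by move=> b F G; change (0 = b *: 0 + 0 :> R[i]^o); rewrite scaler0 addr0.
- by exists 0 => F; rewrite normc0 mul0r.
- move=> b F G; change (a *: m (b *: F + G) + n (b *: F + G) =
    b *: (a *: m F + n F) + (a *: m G + n G)).
  rewrite lm ln !scalerDr !scalerA [a * b]mulrC.
  by rewrite -!addrA; congr (_ + _); rewrite addrCA.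
exists (normc a * c + d) => F.
change (normc (a * m F + n F) <= (normc a * c + d) * L0inf_norm F).
apply: le_trans (normcD _ _) _.
rewrite mulrDl lerD// normcM -mulrA ler_wpM2l//.
by case: (a) => ? ?; rewrite sqrtr_ge0.
Qed.

HB.instance Definition _ :=
  GRing.isSubmodClosed.Build R[i] (L0inf -> R[i]^o) dual_pred
    dual_pred_submod_closed.

Record dual := Dual { dual_val :> L0inf -> R[i]^o; _ : dual_val \in dual_pred }.

HB.instance Definition _ := [isSub for dual_val].
HB.instance Definition _ := gen_eqMixin dual.
HB.instance Definition _ := gen_choiceMixin dual.
HB.instance Definition _ := [SubChoice_isSubLmodule of dual by <:].

Definition dual_norm (n : dual) : R :=
  sup [set normc (n F) | F in [set F | L0inf_norm F <= 1]].

(* The element n F of L_0^oo(w), unique when it exists because locally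
   integrable functions are determined a.e. by their integrals against L^1(w);
   it does exist, since phi |-> n (F phi) is a bounded functional on L^1(w), so
   the default 0 of xget is not reached. *)
Definition dual_act (n : dual) (F : L0inf) : L0inf :=
  xget 0 [set G : L0inf | forall phi, in_L1 phi ->
    cintegral `[0, +oo[ (fun x => repr G x * phi x) =
    n (L0inf_class (translate_integral (repr F) phi))].

(* first Arens product: <m n, F> = <m, n F>; again F |-> <m, n F> does belong to
   the dual, and insubd only serves to repackage it *)
Definition arens (m n : dual) : dual := insubd 0 (fun F => m (dual_act n F)).

Definition ran : set dual := [set r | forall a, arens a r = 0].

(* iter k (arens m) m is m^(k+1), which needs no unit in the algebra *)
Definition spectral_radius (m : dual) : R :=
  limn (fun k => dual_norm (iter k (arens m) m) `^ (k.+1%:R^-1)).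

Implicit Types (S : set dual) (theta D : dual -> dual).

Definition homomorphism theta :=
  linear theta /\ {morph theta : m n / arens m n}.

(* a map from S to S is given by a map on the whole dual; only its values on S
   matter *)
Definition theta_derivation_on S theta D :=
  [/\ forall m, S m -> S (D m),
      forall a m n, S m -> S n -> D (a *: m + n) = a *: D m + D n &
      forall m n, S m -> S n ->
        D (arens m n) = arens (D m) (theta n) + arens (theta m) (D n)].

Definition spectrally_bounded_on S D :=
  exists2 c : R, 0 <= c &
    forall m, S m -> spectral_radius (D m) <= c * spectral_radius m.

End weighted_spaces.

Arguments ran {R} w _.

(* Main.v *)
(* For s > 0 the exponential e_s(x) = exp(-s x) lies in L_0^oo(w) and satisfies
   n e_s = <n, e_s> e_s, so chi_s(n) = <n, e_s> is a character of the algebra.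
   If every chi_s kills n then n lies in ran(A): the product of f with the
   indicator function of [0, a] is continuous, and by Weierstrass' theorem (in
   the variable t = exp(-x)) exponentials are dense in the continuous functions
   of L_0^oo(w), so n f has zero primitive.  Hence elements of square zero are
   in ran(A), and theta maps ran(A) into itself.  The algebra has a right
   identity E, an ultrafilter limit of the averages over [0, 1/k]; p = theta(E)
   is idempotent, so chi_s(p) is 0 or 1, and does not depend on s by continuity.
   If p is in ran(A), then theta(m) = theta(m) p = 0 and D(r) = D(r E) = 0.
   Otherwise, for r in ran(A), 0 = D(E r) = D(E) theta(r) + p D(r) = p D(r)
   forces chi_s(D(r)) = 0 for all s, so D(r) is in ran(A).  Products with right
   factor in ran(A) vanish, which gives both (i) and (ii).
   The one piece of duality used, that n f is given by a function at all, comes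
   from the Radon-Nikodym theorem. *)

From HB Require Import structures.
From mathcomp Require Import all_boot all_order all_algebra finmap.
From mathcomp Require Import all_classical all_reals all_analysis.
From mathcomp Require Import measurable_realfun ess_sup_inf complex.
From mathcomp Require Import ring lra.
Require Import Defs.

Set Implicit Arguments.
Unset Strict Implicit.
Unset Printing Implicit Defensive.

Import Order.TTheory GRing.Theory Num.Theory.
Import numFieldNormedType.Exports.
Import ComplexField.Normc.

Local Open Scope classical_set_scope.
Local Open Scope quotient_scope.
Local Open Scope complex_scope.
Local Open Scope ring_scope.

(** * Uniform approximation by Bernstein polynomials *)

(** Neither [theta] nor a derivation is assumed continuous, so no limit can be passed through these
    maps: they enter only through algebraic identities, and all the analysis is spent on the algebra
    itself. A functional that kills every exponential also kills their closed span, but that span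
    consists of classes of continuous functions, so the functional need not be 0. This is why the
    conclusion is membership in [ran w] and not vanishing. The same continuity produces [E]. The
    primitive of [E F] at [a] is the value of [E] on the product of [F] with the indicator of
    [[0, a]]; this product is continuous with value [\int_0^a F] at 0, so its averages near 0
    converge to that integral and [E F = F]. For a general [F] the averages need not converge, and
    the ultrafilter is there to define [E] on the whole space. The function spaces are treated
    through real and imaginary parts and a.e. bounds [|f| <= M w] on half-lines. *)

Section bernstein.
Variable R : realType.
Implicit Types (f g : nat -> R) (t : R).

(* [bernstein n f] is the polynomial \sum_k 'C(n, k) f(k) X^k (1 - X)^(n - k),
   here defined through Pascal's rule. *)
Fixpoint bernstein n f : {poly R} :=
  if n is n'.+1 then
    (1 - 'X) * bernstein n' f + 'X * bernstein n' (fun k => f k.+1)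
  else (f 0%N)%:P.

Lemma bernsteinS n f t : (bernstein n.+1 f).[t] =
  (1 - t) * (bernstein n f).[t] + t * (bernstein n (fun k => f k.+1)).[t].
Proof. by rewrite /= !(hornerE, hornerM). Qed.

Lemma bernstein_lin n (a : R) f g t :
  (bernstein n (fun k => a * f k + g k)).[t] =
  a * (bernstein n f).[t] + (bernstein n g).[t].
Proof.
elim: n f g => [|n IH] f g; first by rewrite /= !hornerC.
by rewrite !bernsteinS !IH; ring.
Qed.

Lemma bernstein_cst n (a t : R) : (bernstein n (fun=> a)).[t] = a.
Proof. by elim: n => [|n IH]; rewrite ?bernsteinS ?IH /= ?hornerC//; ring. Qed.

Lemma bernstein_at0 n f : (bernstein n f).[0] = f 0%N.
Proof. by elim: n => [|n IH]; rewrite ?bernsteinS ?IH /= ?hornerC//; ring. Qed.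

(** For [t] in [0, 1], [bernstein n f] at [t] is the expectation of [f k] for [k] binomial with
    parameters [n] and [t]; this is the second moment about [c], variance plus squared bias. The
    centre [c] is kept free because Pascal's rule shifts it by one in the induction. *)
Lemma bernstein_sqr n t (c : R) : (bernstein n (fun k => (k%:R - c) ^+ 2)).[t] =
  n%:R * t * (1 - t) + (n%:R * t - c) ^+ 2.
Proof.
elim: n c => [|n IH] c; first by rewrite /= hornerC; ring.
rewrite bernsteinS IH.
rewrite (_ : (fun k => (k.+1%:R - c) ^+ 2) =
    (fun k => (k%:R - (c - 1)) ^+ 2)); last first.
  by apply/funext => k; rewrite -natr1; congr (_ ^+ 2); ring.
by rewrite IH -natr1; ring.
Qed.

Lemma ler_bernstein n f g t : 0 <= t <= 1 ->
  (forall k, (k <= n)%N -> f k <= g k) ->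
  (bernstein n f).[t] <= (bernstein n g).[t].
Proof.
move=> t01; elim: n f g => [|n IH] f g fg; first by rewrite /= !hornerC fg.
rewrite !bernsteinS lerD// ler_wpM2l//; try lra.
- by apply: IH => k kn; apply: fg; apply: leqW.
- by apply: IH => k kn; apply: fg.
Qed.

(** The error term is quadratic so that its binomial expectation is given by [bernstein_sqr].
    Uniform continuity yields [e] for close points; at distance at least [d] the crude bound [2 * M]
    is at most [2 * M / d ^+ 2 * (s - t) ^+ 2]. *)
Lemma continuous_modulus (h : R -> R) (e : R) : continuous h -> 0 < e ->
  exists2 C : R, 0 <= C & forall s t, 0 <= s <= 1 -> 0 <= t <= 1 ->
    `|h s - h t| <= e + C * (s - t) ^+ 2.
Proof.
move=> hc e0.
have : \forall d \near 0^'+, `[0, 1] `<=` [set t | forall s, `|s - t| < d ->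
    `|h s - h t| <= e].
  (* Heine's theorem: compactness, as a near-covering property, provides one [d] valid at every
     point of the segment. *)
  have /compact_near_coveringP := @segment_compact R 0 1.
  apply => x _.
  have : \forall z \near x, `|h x - h z| < e / 2.
    by have /cvgrPdist_lt/(_ (e / 2)) := hc x; apply; rewrite divr_gt0.
  move=> /nbhs_ballP[r /= r0 rP].
  exists (ball x (r / 2), [set d : R | d < r / 2]).
    split => /=; first by apply: nbhsx_ballx; rewrite divr_gt0.
    by apply: nbhs_right_lt; rewrite divr_gt0.
  move=> [y d] /= [xy dr] s sy.
  have h1 : `|h x - h y| < e / 2.
    by apply: rP; apply: le_ball xy; lra.
  have h2 : `|h x - h s| < e / 2.
    apply: rP; rewrite /ball/= in xy *.
    rewrite (_ : x - s = (x - y) - (s - y)); last by ring.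
    by apply: le_lt_trans (ler_normB _ _) _; lra.
  rewrite (_ : h s - h y = (h x - h y) - (h x - h s)); last by ring.
  by apply: le_trans (ler_normB _ _) _; lra.
move=> near_d.
have [d d0 dP] : exists2 d : R, 0 < d & `[0, 1] `<=` [set t | forall s,
    `|s - t| < d -> `|h s - h t| <= e].
  near (0 : R)^'+ => d; exists d => //; near: d; exact: near_d.
have [M M0 MP] : exists2 M : R, 0 <= M & forall t, 0 <= t <= 1 -> `|h t| <= M.
  have [|c cI cP] := @EVT_max R (fun x => `|h x|) 0 1 ler01.
    apply: continuous_subspaceT => x.
    by apply: continuous_comp; [exact: hc|exact: norm_continuous].
  by exists `|h c| => // t t01; apply: cP; rewrite in_itv/=.
exists (2 * M / d ^+ 2) => [|s t s01 t01].
  by apply: divr_ge0; [exact: mulr_ge0|exact: sqr_ge0].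
have [std|dst] := ltP `|s - t| d.
  apply: le_trans (dP t _ s std) _; first by rewrite /= in_itv.
  by rewrite lerDl; apply: mulr_ge0; [apply: divr_ge0; [exact: mulr_ge0|]|];
    exact: sqr_ge0.
apply: le_trans (ler_normB _ _) _.
have : 2 * M <= 2 * M / d ^+ 2 * (s - t) ^+ 2.
  rewrite -mulrA ler_peMr ?mulr_ge0// mulrC ler_pdivlMr ?exprn_gt0// mul1r.
  by rewrite -[leRHS]real_normK ?num_real// lerXn2r// ?nnegrE// ltW.
by have := MP s s01; have := MP t t01; lra.
Unshelve. all: by end_near. Qed.

(** Bernstein polynomials reproduce the value at 0, so [p] has no constant term. After the
    substitution by [exp(-x)] only decaying exponentials occur, whereas a constant need not lie in
    L_0^oo(w). *)
Lemma weierstrass_approx (h : R -> R) (e : R) :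
  continuous h -> h 0 = 0 -> 0 < e ->
  exists2 p : {poly R}, p.[0] = 0 &
    forall t, 0 <= t <= 1 -> `|h t - p.[t]| <= e.
Proof.
move=> hc h00 e0.
have [||C C0 hC] := @continuous_modulus h (e / 2) => //; first by rewrite divr_gt0.
(* The variance of [k / n] is [t (1 - t) / n], so the quadratic term contributes at most [C / n],
   which this [n] makes at most [e / 2]. *)
pose n := (Num.trunc (2 * C / e)).+1.
have n0 : (0 : R) < n%:R by rewrite ltr0n.
have nC : C / n%:R <= e / 2.
  have : 2 * C / e < n%:R by rewrite /n truncnS_gt.
  rewrite ltr_pdivrMr// => h1.
  by rewrite ler_pdivrMr//; lra.
exists (bernstein n (fun k => h (k%:R / n%:R))) => [|t t01].
  by rewrite bernstein_at0 mul0r.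
have kn k : (k <= n)%N -> 0 <= (k%:R / n%:R : R) <= 1.
  by move=> ?; rewrite divr_ge0//= ler_pdivrMr// mul1r ler_nat.
have var : (bernstein n (fun k => C / n%:R ^+ 2 * (k%:R - n%:R * t) ^+ 2
    + (h t + e / 2))).[t] <= h t + e.
  rewrite bernstein_lin bernstein_cst bernstein_sqr subrr expr0n/= addr0.
  rewrite (_ : _ / _ * _ = C / n%:R * (t * (1 - t))); last first.
    by field; rewrite gt_eqF.
  have : C / n%:R * (t * (1 - t)) <= C / n%:R * 1.
    by rewrite ler_wpM2l ?divr_ge0//; nra.
  by lra.
have var' : h t - e <= (bernstein n (fun k => - (C / n%:R ^+ 2) *
    (k%:R - n%:R * t) ^+ 2 + (h t - e / 2))).[t].
  rewrite bernstein_lin bernstein_cst bernstein_sqr subrr expr0n/= addr0.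
  rewrite (_ : - (_ / _) * _ = - (C / n%:R * (t * (1 - t)))); last first.
    by field; rewrite gt_eqF.
  have : C / n%:R * (t * (1 - t)) <= C / n%:R * 1.
    by rewrite ler_wpM2l ?divr_ge0//; nra.
  by lra.
have sq k : C / n%:R ^+ 2 * (k%:R - n%:R * t) ^+ 2 =
    C * (k%:R / n%:R - t) ^+ 2 by field; rewrite gt_eqF.
have up := ler_bernstein t01 (f := fun k => h (k%:R / n%:R)) (n := n)
  (g := fun k => C / n%:R ^+ 2 * (k%:R - n%:R * t) ^+ 2 + (h t + e / 2)).
have lo := ler_bernstein t01 (g := fun k => h (k%:R / n%:R)) (n := n)
  (f := fun k => - (C / n%:R ^+ 2) * (k%:R - n%:R * t) ^+ 2 + (h t - e / 2)).
rewrite ler_norml; apply/andP; split.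
  suff : (bernstein n (fun k => h (k%:R / n%:R))).[t] <= h t + e by lra.
  apply: le_trans (up _) var => k k_n.
  by have := hC _ _ (kn _ k_n) t01; rewrite sq ler_norml; lra.
suff : h t - e <= (bernstein n (fun k => h (k%:R / n%:R))).[t] by lra.
apply: le_trans var' (lo _) => k k_n.
by have := hC _ _ (kn _ k_n) t01; rewrite mulNr sq ler_norml; lra.
Qed.

End bernstein.

(** * Lebesgue measure on the half-line *)

#[local] Instance lebesgue_ae_filter (R : realType) :
  Filter (nbhs (almost_everywhere (@lebesgue_measure R))).
Proof. exact: ae_filter_ringOfSetsType. Qed.

Section lebesgue_shift.
Variable R : realType.
Notation mu := (@lebesgue_measure R).
Implicit Types (x a : R) (D : set R).

Lemma preimage_addl_itv x (b c : bool) (u v : R) :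
  (fun y => x + y) @^-1` [set` Interval (BSide b u) (BSide c v)] =
  [set` Interval (BSide b (u - x)) (BSide c (v - x))].
Proof.
apply/seteqP; split => y /=; rewrite !in_itv/=; case: b; case: c => /= /andP[h1 h2];
  by apply/andP; split; lra.
Qed.

Let addl x (y : measurableTypeR R) : measurableTypeR R := x + y.

Let measurable_addl x : measurable_fun setT (addl x).
Proof. exact: measurable_funD. Qed.

Let addl_mfun x : {mfun measurableTypeR R >-> measurableTypeR R} :=
  HB.pack (addl x) (isMeasurableFun.Build _ _ _ _ _ (measurable_addl x)).

(** Both sides are measures in [D] that agree on the intervals []a, b]], and these values determine
    Lebesgue measure. *)
Lemma lebesgue_measure_shift x D : measurable D ->
  mu ((fun y => x + y) @^-1` D) = mu D.
Proof.
move=> mD; apply/esym.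
apply: (@lebesgue_measure_unique _ (pushforward mu (addl_mfun x))) => //.
move=> _ [[a b]] _ <-.
transitivity (mu `]a - x, b - x]); last by rewrite -preimage_addl_itv.
rewrite !lebesgue_measure_itv/=.
by rewrite !lte_fin ltrD2r; case: ifP => // _; congr (_%:E); ring.
Qed.

Lemma ae_shift x (P : R -> Prop) :
  (\forall z \ae mu, P z) -> \forall y \ae mu, P (x + y).
Proof.
move=> [N [mN N0 NP]]; exists ((fun y => x + y) @^-1` N); split => //.
- by rewrite -[X in measurable X]setTI; exact: measurable_funD.
- by rewrite lebesgue_measure_shift.
- by move=> y /= nP; apply: NP.
Qed.

Lemma integral_shift x D (f : R -> \bar R) : measurable D -> measurable_fun D f ->
  (\int[mu]_(z in D) f z = \int[mu]_(y in (fun y => (x + y)%R) @^-1` D) f (x + y)%R)%E.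
Proof.
move=> mD mf.
have ge0 (g : R -> \bar R) : measurable_fun D g -> (forall z, 0 <= g z)%E ->
    (\int[mu]_(z in D) g z = \int[mu]_(y in addl x @^-1` D) g (addl x y))%E.
  move=> mg g0; rewrite -(ge0_integral_pushforward (measurable_addl x))//.
  by apply: eq_measure_integral => //= A mA _; exact/esym/lebesgue_measure_shift.
rewrite integralE [RHS]integralE !ge0//.
- by rewrite !unlock.
- exact: measurable_funeneg.
- exact: measurable_funepos.
Qed.

End lebesgue_shift.

(** * Primitives of locally integrable functions on the half-line *)

Section primitive.
Variable R : realType.
Notation mu := (@lebesgue_measure R).
Implicit Types (x a : R) (f : R -> R).

Definition locint f := measurable_fun (`[0, +oo[ : set R) f /\
  forall N : R, mu.-integrable `[0, N] (EFin \o f).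

Lemma locint_patch f : locint f ->
  locally_integrable [set: R] (f \_ `[0, +oo[).
Proof.
move=> [mf intf]; split; first 1 last.
- exact: openT.
- move=> K _ cK.
  have [M [_ MK]] := compact_bounded cK.
  have KN : K `<=` [set y | `|y| <= M + 1] by apply: MK; rewrite ltrDl.
  have mK : measurable K by exact: compact_measurable.
  have /integrableP[mfN] := intf (M + 1); apply: le_lt_trans.
  rewrite (_ : (fun x => _) = (fun x => `|f x|%:E) \_ `[0, +oo[); last first.
    by apply/funext => x; rewrite !patchE; case: ifP; rewrite ?normr0.
  rewrite -integral_mkcondr; apply: ge0_subset_integral => //=.
  + exact: measurableI.
  + apply/measurable_EFinP/measurableT_comp => //.
    exact/measurable_EFinP.
  + move=> y [/KN/= yM]; rewrite !in_itv/= andbT => y0; rewrite y0/=.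
    by apply: le_trans yM; exact: ler_norm.
- by apply/measurable_restrict => //; rewrite setTI.
Qed.

(** Lebesgue differentiation: almost everywhere [f] is the derivative of its primitive, which is
    constant here. *)
Lemma ae_eq0_primitive f : locint f ->
  (forall a, 0 <= a -> \int[mu]_(x in `[0, a]) f x = 0) ->
  \forall x \ae mu, 0 <= x -> f x = 0.
Proof.
move=> lf f0; have [mf intf] := lf.
pose g := f \_ `[0, +oo[.
have gf x : 0 <= x -> g x = f x.
  by move=> x0; rewrite /g patchE ifT// inE/= in_itv/= x0.
have intg y : mu.-integrable [set` Interval (BLeft 0) (BRight y)] (EFin \o g).
  apply: eq_integrable (intf y) => //= x; rewrite inE/= in_itv/= => /andP[x0 _].
  by rewrite gf.
(* The differentiation theorem speaks of points strictly to the right of the base point 0, which is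
   discarded as a null set. *)
have ne0 : \forall x \ae mu, x != 0.
  exists [set 0]; split => //; first exact: lebesgue_measure_set1.
  by move=> x /= /negP; rewrite negbK => /eqP.
have := FTC1 intg (locint_patch lf).
apply: filterS2 ne0.
move=> x /= xn0 xP x0; rewrite -gf//.
have [|_ <-] := xP; first by rewrite lte_fin lt_def xn0.
rewrite (_ : (fun y => _) = cst 0) ?derive1_cst//.
apply/funext => y /=; have [y0|y0] := leP 0 y; last first.
  by rewrite set_itv_ge ?Rintegral_set0// bnd_simp -ltNge.
rewrite -[RHS](f0 y y0); apply: eq_Rintegral => z.
by rewrite inE/= in_itv/= => /andP[z0 _]; rewrite gf.
Qed.

(** For negative [x] the interval is empty and the primitive is 0, so continuity makes sense on the
    whole line. Locally the primitive is the integral from [- N] of the extension by zero, with [N]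
    chosen to put [x] in the interior. *)
Lemma continuous_primitive f : locint f ->
  continuous (fun x => \int[mu]_(y in `[0, x]) f y).
Proof.
move=> lf x; have [mf intf] := lf.
pose g := f \_ `[0, +oo[.
pose N := `|x| + 1.
have xN : x \in `]- N, N[ by rewrite in_itv/= -ltr_norml /N ltrDl.
have intg : mu.-integrable `[- N, N] (EFin \o g).
  have -> : EFin \o g = (EFin \o f) \_ `[0, +oo[ by rewrite /g restrict_EFin.
  apply/integrable_restrict => //.
  apply: integrableS (intf N) => //; first exact: measurableI.
  by move=> y [] /=; rewrite !in_itv/= andbT => /andP[_ ->] ->.
have NN : - N <= N by rewrite /N ge0_cp// addr_ge0.
have Nlt : - N < N by rewrite /N; have := normr_ge0 x; lra.
have cF := parameterized_integral_continuous NN intg.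
have eqF y : \int[mu]_(z in `[0, y]) f z = parameterized_integral mu (- N) y g.
  rewrite /parameterized_integral /g -Rintegral_mkcondr.
  congr (Rintegral _ _ _); apply/seteqP; split => z /=; rewrite !in_itv/= andbT.
    by move=> /andP[z0 zy]; rewrite z0 zy (le_trans _ z0)// oppr_le0 addr_ge0.
  by move=> [/andP[_ ->] ->].
have /funext -> := eqF.
exact: within_continuous_continuous Nlt cF xN.
Qed.

(** Writing the translated integral through the primitive exhibits it as a continuous function of
    [x], even when [f] is discontinuous. *)
Lemma integral_window f a x : locint f -> 0 <= a -> 0 <= x ->
  \int[mu]_(y in `[0, a]) f (x + y) =
  \int[mu]_(y in `[0, x + a]) f y - \int[mu]_(y in `[0, x]) f y.
Proof.
move=> [mf intf] a0 x0.
rewrite (@Rintegral_itvB _ _ (BLeft 0) (BRight (x + a)) x); last 3 first.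
  exact: intf.
  by rewrite bnd_simp.
  by rewrite bnd_simp lerDl.
rewrite Rintegral_itv_obnd_cbnd; last first.
  apply: integrableS (intf (x + a)) => //=.
  by move=> y /=; rewrite !in_itv/= => /andP[xy ->]; rewrite (le_trans x0 (ltW xy)).
rewrite /Rintegral [in RHS](@integral_shift _ x)//; last first.
  apply/measurable_EFinP; apply: measurable_funS mf => // y/=.
  by rewrite !in_itv/= andbT => /andP[xy _]; exact: le_trans xy.
by rewrite preimage_addl_itv subrr (addrC x) addrK.
Qed.

End primitive.

(** * Domination, measurability and linearity of real integrals *)

Section real_integrals.
Variable R : realType.
Notation mu := (@lebesgue_measure R).
Implicit Types (D : set R) (f g : R -> R).

Lemma integrable_ae_le D f g : measurable D -> measurable_fun D f ->
  mu.-integrable D (EFin \o g) -> (forall x, D x -> 0 <= g x) ->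
  (\forall x \ae mu, D x -> `|f x| <= g x) -> mu.-integrable D (EFin \o f).
Proof.
move=> mD mf /integrableP[mg ig] g0 fg; apply/integrableP; split.
  exact/measurable_EFinP.
apply: le_lt_trans ig; apply: ae_ge0_le_integral => //.
- by do 2 apply: measurableT_comp => //.
- by apply: measurableT_comp.
- apply: filterS fg.
  by move=> x fg Dx /=; rewrite lee_fin (le_trans (fg Dx))// ler_norm.
Qed.

Lemma normr_Rintegral_ae_le D f g : measurable D -> measurable_fun D f ->
  mu.-integrable D (EFin \o g) -> (forall x, D x -> 0 <= g x) ->
  (\forall x \ae mu, D x -> `|f x| <= g x) ->
  `|\int[mu]_(x in D) f x| <= \int[mu]_(x in D) g x.
Proof.
move=> mD mf ig g0 fg; have intf := integrable_ae_le mD mf ig g0 fg.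
apply: le_trans (le_normr_Rintegral _ _) _ => //.
apply: fine_le; [exact: integrable_fin_num (integrable_norm intf)|
  exact: integrable_fin_num|].
have /integrableP[mg _] := ig.
apply: ae_ge0_le_integral => //.
by apply/measurable_EFinP; apply: measurableT_comp.
Qed.

Lemma ae_eq_Rintegral D f g : measurable D -> measurable_fun D f ->
  measurable_fun D g -> (\forall x \ae mu, D x -> f x = g x) ->
  \int[mu]_(x in D) f x = \int[mu]_(x in D) g x.
Proof.
move=> mD mf mg fg; congr fine; apply: ae_eq_integral => //.
- exact/measurable_EFinP.
- exact/measurable_EFinP.
- apply: filterS fg.
  by move=> x fg Dx; rewrite fg.
Qed.

(** Tonelli's theorem is applied to the positive and negative parts, and [fine] turns the difference
    of the two extended integrals into the real one. *)
Lemma measurable_Rintegral_section (k : R * R -> R) :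
  measurable_fun setT k ->
  measurable_fun setT (fun x => \int[mu]_(y in setT) k (x, y)).
Proof.
move=> mk.
have mp : measurable_fun setT (fun x => \int[mu]_y ((EFin \o k)^\+ (x, y)))%E.
  apply: (@measurable_fun_fubini_tonelli_F _ _ _ _ _ mu (EFin \o k)^\+%E) => //.
  exact/measurable_funepos/measurable_EFinP.
have mn : measurable_fun setT (fun x => \int[mu]_y ((EFin \o k)^\- (x, y)))%E.
  apply: (@measurable_fun_fubini_tonelli_F _ _ _ _ _ mu (EFin \o k)^\-%E) => //.
  exact/measurable_funeneg/measurable_EFinP.
rewrite (_ : (fun x => _) = fine \o (fun x =>
  \int[mu]_y ((EFin \o k)^\+ (x, y)) - \int[mu]_y ((EFin \o k)^\- (x, y)))%E).
  by apply: measurableT_comp; [exact: fine_measurable|exact: emeasurable_funB].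
apply/funext => x /=; rewrite /Rintegral integralE; congr (fine (_ - _)).
  by apply: eq_integral => y _; rewrite !unlock.
by apply: eq_integral => y _; rewrite !unlock.
Qed.

Lemma integrable_lin D a f g : measurable D -> mu.-integrable D (EFin \o f) ->
  mu.-integrable D (EFin \o g) ->
  mu.-integrable D (EFin \o (fun x => a * f x + g x)).
Proof.
move=> mD intf intg; have intaf : mu.-integrable D (EFin \o (fun x => a * f x)).
  by have := @integrableZl _ _ _ mu D mD a _ intf; apply: eq_integrable.
by have := @integrableD _ _ _ mu D mD _ _ intaf intg; apply: eq_integrable.
Qed.

Lemma Rintegral_lin D a f g : measurable D -> mu.-integrable D (EFin \o f) ->
  mu.-integrable D (EFin \o g) ->
  \int[mu]_(x in D) (a * f x + g x) =
  a * \int[mu]_(x in D) f x + \int[mu]_(x in D) g x.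
Proof.
move=> mD intf intg; rewrite -RintegralZl// -RintegralD//.
by have := @integrableZl _ _ _ mu D mD a _ intf; apply: eq_integrable.
Qed.

End real_integrals.

(** * Real weighted spaces and the translation product *)

Section weighted_reals.
Context {R : realType} (w : weight R).
Notation mu := (@lebesgue_measure R).
Notation J := (`[0%R, +oo[%classic : set R).
Implicit Types (f g phi : R -> R) (X M : R).

Lemma weight_gt0 x : 0 <= x -> 0 < w x.
Proof. by move=> x0; apply: lt_le_trans (weight_ge1 w x0). Qed.

Lemma measurable_weight : measurable_fun J w.
Proof.
by apply: subspace_continuous_measurable_fun => //; exact: weight_continuous.
Qed.

Lemma weight_bounded N : exists2 M, 0 <= M & forall x, 0 <= x <= N -> w x <= M.
Proof.
have [N0|N0] := leP 0 N; last first.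
  by exists 0 => // x /andP[x0 /(le_trans x0)]; rewrite leNgt N0.
have [|c cI cP] := @EVT_max R w 0 N N0.
  apply: continuous_subspaceW (@weight_continuous _ w) => x /=.
  by rewrite !in_itv/= andbT => /andP[].
exists (w c); first by move: cI; rewrite in_itv/= => /andP[/weight_gt0/ltW].
by move=> x xN; apply: cP; rewrite in_itv.
Qed.

(* Real-valued counterparts of [in_L1] and [in_L0inf]: with [rbnd X M f], that is
   |f| <= M w a.e. on [X, +oo[, the limit of essential suprema in [in_L0inf]
   becomes an epsilon-X statement about a.e. bounds. *)
Definition rL1 phi := measurable_fun J phi /\
  mu.-integrable J (EFin \o (fun x => w x * phi x)).

Definition nrm1 phi := \int[mu]_(x in J) (w x * `|phi x|).

Definition rbnd X M f := \forall x \ae mu, X <= x -> `|f x| <= M * w x.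

Definition rL0 f := [/\ measurable_fun J f,
  exists2 M, 0 <= M & rbnd 0 M f &
  forall e, 0 < e -> exists2 X, 0 <= X & rbnd X e f].

Lemma J_ge0 x : J x <-> 0 <= x.
Proof. by rewrite /= in_itv/= andbT. Qed.

Lemma integrable_wnorm phi : rL1 phi ->
  mu.-integrable J (EFin \o (fun x => w x * `|phi x|)).
Proof.
move=> [mphi iphi]; apply: eq_integrable (integrable_norm iphi) => // x.
by rewrite inE => /J_ge0 x0 /=; rewrite normrM (ger0_norm (ltW (weight_gt0 x0))).
Qed.

Lemma nrm1_ge0 phi : 0 <= nrm1 phi.
Proof.
by apply: Rintegral_ge0 => x /J_ge0 x0; rewrite mulr_ge0// ltW// weight_gt0.
Qed.

Lemma rL1_lin a phi psi : rL1 phi -> rL1 psi ->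
  rL1 (fun x => a * phi x + psi x).
Proof.
move=> [mp ip] [mq iq]; split.
  by apply: measurable_funD => //; exact: measurable_funM.
have := @integrable_lin _ J a _ _ (measurable_itv _) ip iq.
by apply: eq_integrable => // x _ /=; congr (_%:E); ring.
Qed.

(** These indicators are the test functions of L^1(w): pairing with them gives the primitive, which
    determines a function almost everywhere. *)
Definition step (a x : R) : R := \1_`[0, a] x.

Lemma measurable_step a D : measurable_fun D (step a).
Proof. exact: measurable_indic. Qed.

Lemma Rintegral_step f a : \int[mu]_(x in J) (f x * step a x) =
  \int[mu]_(x in `[0, a]) f x.
Proof.
have -> : `[0, a]%classic = J `&` `[0, a].
  by rewrite setIidr// => x /=; rewrite !in_itv/= andbT => /andP[].
rewrite Rintegral_mkcondr; apply: eq_Rintegral => x _.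
by rewrite /step patchE indicE; case: ifP; rewrite ?mulr1 ?mulr0.
Qed.

Lemma integrable_step f a : measurable_fun J f ->
  mu.-integrable `[0, a] (EFin \o f) ->
  mu.-integrable J (EFin \o (fun x => f x * step a x)).
Proof.
move=> mf intf.
have -> : EFin \o (fun x => f x * step a x) = (EFin \o f) \_ `[0, a].
  apply/funext => x /=; rewrite /step patchE indicE.
  by case: ifP; rewrite ?mulr1 ?mulr0.
apply/integrable_restrict => //; rewrite setIidr//.
by move=> x /=; rewrite !in_itv/= andbT => /andP[].
Qed.

Lemma locint_rbnd f M : measurable_fun J f -> 0 <= M -> rbnd 0 M f -> locint f.
Proof.
move=> mf M0 bf; split=> // N.
have [C C0 CP] := weight_bounded N.
have mfN : measurable_fun (`[0, N] : set R) f.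
  by apply: measurable_funS mf => // x/=; rewrite !in_itv/= andbT => /andP[].
apply: (@integrable_ae_le _ _ _ (cst (M * C))) => //.
- apply/integrableP; split; first exact/measurable_EFinP.
  rewrite (eq_integral (cst `|M * C|%:E))// integral_cst//= lte_mul_pinfty//.
  by rewrite lebesgue_measure_itv/=; case: ifP => //; rewrite -EFinB ltry.
- by move=> x _; rewrite mulr_ge0.
- apply: filterS bf.
  move=> x fx /=; rewrite in_itv/= => xN; have /andP[x0 _] := xN.
  by apply: le_trans (fx x0) _; rewrite ler_wpM2l// CP.
Qed.

Lemma locint_weight : locint w.
Proof.
apply: (@locint_rbnd _ 1) => //; first exact: measurable_weight.
apply: aeW => x x0; rewrite mul1r ger0_norm//; exact/ltW/weight_gt0.
Qed.

Lemma rL1_step a : rL1 (step a).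
Proof.
split; first exact: measurable_step.
apply: integrable_step; first exact: measurable_weight.
by have [_] := locint_weight; apply.
Qed.

Lemma rL0_ext f g : (forall x, 0 <= x -> f x = g x) -> rL0 f -> rL0 g.
Proof.
move=> e [mf [M M0 bM] tf]; split.
- by apply: eq_measurable_fun mf => x; rewrite inE => /J_ge0; exact: e.
- by exists M => //; apply: filterS bM => x h x0; rewrite -e//; exact: h.
- move=> d /tf[X X0 bX]; exists X => //; apply: filterS bX => x h Xx.
  by rewrite -e ?h//; exact: le_trans Xx.
Qed.

Lemma rL0_locint f : rL0 f -> locint f.
Proof. by move=> [mf [M M0 bf] _]; exact: locint_rbnd bf. Qed.

Lemma rbnd_le X Y M N f : 0 <= Y -> X <= Y -> M <= N -> rbnd X M f -> rbnd Y N f.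
Proof.
move=> Y0 XY MN; apply: filterS.
move=> x fx Yx; apply: le_trans (fx (le_trans XY Yx)) _.
by rewrite ler_wpM2r// ltW// weight_gt0// (le_trans Y0).
Qed.

Lemma rbnd_lin X a M N f g : 0 <= X -> rbnd X M f -> rbnd X N g ->
  rbnd X (`|a| * M + N) (fun x => a * f x + g x).
Proof.
move=> X0; apply: filterS2.
move=> x fx gx Xx; apply: le_trans (ler_normD _ _) _.
by rewrite mulrDl normrM -mulrA lerD ?gx// ler_wpM2l ?fx.
Qed.

Lemma rL0_lin a f g : rL0 f -> rL0 g -> rL0 (fun x => a * f x + g x).
Proof.
move=> [mf [M M0 bf] tf] [mg [N N0 bg] tg]; split.
- by apply: measurable_funD => //; exact: measurable_funM.
- by exists (`|a| * M + N); [rewrite addr_ge0// mulr_ge0|exact: rbnd_lin].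
- move=> e e0.
  have a1 : 0 < `|a| + 1 by rewrite ltr_wpDl.
  have [X X0 bX] := tf (e / (`|a| + 1)) (divr_gt0 e0 a1).
  have [Y Y0 bY] := tg (e / (`|a| + 1)) (divr_gt0 e0 a1).
  have XY0 : 0 <= Num.max X Y by rewrite le_max X0.
  exists (Num.max X Y) => //.
  have {}bX := @rbnd_le _ (Num.max X Y) _ _ _ XY0 _ (lexx _) bX.
  have {}bY := @rbnd_le _ (Num.max X Y) _ _ _ XY0 _ (lexx _) bY.
  have := rbnd_lin a XY0 (bX _) (bY _); rewrite !le_max !lexx ?orbT.
  move=> /(_ isT isT); rewrite -[X in _ + X]mul1r -mulrDl mulrC divfK//.
Qed.

Lemma ae_of_J (P : R -> Prop) : (forall x, 0 <= x -> P x) ->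
  \forall x \ae mu, J x -> P x.
Proof. by move=> h; apply: aeW => x /J_ge0; exact: h. Qed.

(** Hölder's inequality for the weighted pairing: the factor [w] moves from the bound on [g] to the
    norm of [phi]. *)
Lemma pair_le g phi M : measurable_fun J g -> 0 <= M -> rbnd 0 M g -> rL1 phi ->
  mu.-integrable J (EFin \o (fun x => g x * phi x)) /\
  `|\int[mu]_(x in J) (g x * phi x)| <= M * nrm1 phi.
Proof.
move=> mg M0 bg lphi; have [mphi _] := lphi.
have mgp : measurable_fun J (fun x => g x * phi x) by exact: measurable_funM.
have iwp := integrable_wnorm lphi.
have iM : mu.-integrable J (EFin \o (fun x => M * (w x * `|phi x|))).
  by have := @integrableZl _ _ _ mu J (measurable_itv _) M _ iwp; apply: eq_integrable.
have M_ge0 x : J x -> 0 <= M * (w x * `|phi x|).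
  by move=> /J_ge0 x0; rewrite !mulr_ge0// ltW// weight_gt0.
have le : \forall x \ae mu, J x -> `|g x * phi x| <= M * (w x * `|phi x|).
  apply: filterS bg.
  by move=> x gx /J_ge0 x0; rewrite normrM mulrA ler_wpM2r// gx.
split; first exact: integrable_ae_le iM _ le.
by rewrite /nrm1 -RintegralZl//; exact: normr_Rintegral_ae_le.
Qed.

Lemma rL0_pair g phi : rL0 g -> rL1 phi ->
  mu.-integrable J (EFin \o (fun x => g x * phi x)).
Proof. by move=> [mg [M M0 bg] _] lphi; have [] := pair_le mg M0 bg lphi. Qed.

(* The function written [f phi] in the paper, for real [f] and [phi]. *)
Definition tr f phi x := \int[mu]_(y in J) (f (x + y) * phi y).

Lemma measurable_shift f x : 0 <= x -> measurable_fun J f ->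
  measurable_fun J (fun y => f (x + y)).
Proof.
move=> x0 mf; apply: (@measurable_comp _ _ _ _ _ _ J f J (fun y => x + y)) => //.
  by move=> _ [y /J_ge0 y0 <-]; apply/J_ge0; rewrite addr_ge0.
exact: measurable_funD.
Qed.

(** Submultiplicativity splits [w (x + y)] into the factor [w x] of the bound and the factor [w y]
    of the norm. The last hypothesis confines the integral to arguments beyond [Z], where [f] is
    controlled. It holds when [Z <= x], which gives decay at infinity, and also when [phi] vanishes
    on [[0, Z[], which gives estimates by the tail of [f]. *)
Lemma tr_le Z f phi M x : 0 <= x -> 0 <= Z -> 0 <= M ->
  measurable_fun J f -> rbnd Z M f -> rL1 phi ->
  (forall y, 0 <= y -> x + y < Z -> phi y = 0) ->
  mu.-integrable J (EFin \o (fun y => f (x + y) * phi y)) /\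
  `|tr f phi x| <= M * w x * nrm1 phi.
Proof.
move=> x0 Z0 M0 mf bf lphi phiZ; have [mphi _] := lphi.
have mfp : measurable_fun J (fun y => f (x + y) * phi y).
  by apply: measurable_funM => //; exact: measurable_shift.
have iwp := integrable_wnorm lphi.
have iM : mu.-integrable J (EFin \o (fun y => M * w x * (w y * `|phi y|))).
  by have := @integrableZl _ _ _ mu J (measurable_itv _) (M * w x) _ iwp;
    apply: eq_integrable.
have Mw0 : 0 <= M * w x by rewrite mulr_ge0// ltW// weight_gt0.
have M_ge0 y : J y -> 0 <= M * w x * (w y * `|phi y|).
  by move=> /J_ge0 y0; apply: mulr_ge0 => //; rewrite mulr_ge0// ltW// weight_gt0.
have le : \forall y \ae mu, J y -> `|f (x + y) * phi y| <= M * w x * (w y * `|phi y|).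
  apply: filterS (ae_shift x bf).
  move=> y fy /J_ge0 y0; have [xyZ|Zxy] := ltP (x + y) Z.
    by rewrite phiZ// mulr0 !normr0 !mulr0.
  rewrite normrM mulrA ler_wpM2r//; apply: le_trans (fy Zxy) _.
  by rewrite -mulrA ler_wpM2l// weight_submult.
split; first exact: integrable_ae_le iM _ le.
by rewrite /nrm1 -RintegralZl//; exact: normr_Rintegral_ae_le.
Qed.

Lemma tr_integrable f phi x : 0 <= x -> rL0 f -> rL1 phi ->
  mu.-integrable J (EFin \o (fun y => f (x + y) * phi y)).
Proof.
move=> x0 [mf [M M0 bf] _] lphi.
have phiZ y : 0 <= y -> x + y < 0 -> phi y = 0.
  by move=> y0 xy0; have := addr_ge0 x0 y0; rewrite leNgt xy0.
by have [] := tr_le x0 (lexx 0) M0 mf bf lphi phiZ.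
Qed.

Lemma measurable_tr f phi : measurable_fun J f -> measurable_fun J phi ->
  measurable_fun J (tr f phi).
Proof.
move=> mf mphi.
have mfJ : measurable_fun setT (f \_ J).
  by apply/measurable_restrict => //; rewrite setTI.
have mphiJ : measurable_fun setT (phi \_ J).
  by apply/measurable_restrict => //; rewrite setTI.
have mk : measurable_fun setT (fun z : R * R => (f \_ J) (z.1 + z.2) * (phi \_ J) z.2).
  apply: measurable_funM; last by apply: measurableT_comp.
  by apply: measurableT_comp => //; exact: measurable_funD.
have := measurable_Rintegral_section mk.
move=> /(measurable_funS measurableT (@subsetT _ J)).
apply: eq_measurable_fun => x; rewrite inE => /J_ge0 x0.
rewrite /tr [RHS]Rintegral_mkcond; apply: eq_Rintegral => y _ /=.
rewrite [in RHS]patchE [X in _ * X]patchE; case: ifPn => [|_]; last by rewrite mulr0.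
rewrite inE => /J_ge0 y0; rewrite patchE ifT// inE; apply/J_ge0.
by rewrite addr_ge0.
Qed.

Lemma rL0_tr f phi : rL0 f -> rL1 phi -> rL0 (tr f phi).
Proof.
move=> [mf [M M0 bf] tf] lphi; have [mphi _] := lphi.
have bnd Z N : 0 <= Z -> 0 <= N -> rbnd Z N f ->
    rbnd Z (N * nrm1 phi) (tr f phi).
  move=> Z0 N0 bN; apply: aeW => x Zx; have x0 := le_trans Z0 Zx.
  have phiZ y : 0 <= y -> x + y < Z -> phi y = 0.
    by move=> y0 xyZ; have : Z <= x + y; [rewrite ler_wpDr|rewrite leNgt xyZ].
  by have [_] := tr_le x0 Z0 N0 mf bN lphi phiZ; rewrite mulrAC.
split.
- exact: measurable_tr.
- by exists (M * nrm1 phi); [rewrite mulr_ge0// nrm1_ge0|exact: bnd].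
- move=> e e0; have n1 : 0 < nrm1 phi + 1 by rewrite ltr_wpDl// nrm1_ge0.
  have [X X0 bX] := tf (e / (nrm1 phi + 1)) (divr_gt0 e0 n1).
  exists X => //; have := bnd _ _ X0 (ltW (divr_gt0 e0 n1)) bX.
  apply: rbnd_le => //; rewrite mulrAC ler_pdivrMr// ler_wpM2l ?ltW//.
  by rewrite ltrDl.
Qed.

Lemma tr_linr a f phi psi x : 0 <= x -> rL0 f -> rL1 phi -> rL1 psi ->
  tr f (fun y => a * phi y + psi y) x = a * tr f phi x + tr f psi x.
Proof.
move=> x0 lf lp lq; rewrite /tr -Rintegral_lin//; try exact: tr_integrable.
by apply: eq_Rintegral => y _; ring.
Qed.

Lemma tr_linl a f g phi x : 0 <= x -> rL0 f -> rL0 g -> rL1 phi ->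
  tr (fun y => a * f y + g y) phi x = a * tr f phi x + tr g phi x.
Proof.
move=> x0 lf lg lp; rewrite /tr -Rintegral_lin//; try exact: tr_integrable.
by apply: eq_Rintegral => y _; ring.
Qed.

Lemma tr_ext f g phi x : 0 <= x -> rL0 f -> rL0 g -> rL1 phi ->
  (\forall y \ae mu, 0 <= y -> f y = g y) -> tr f phi x = tr g phi x.
Proof.
move=> x0 [mf _ _] [mg _ _] [mphi _] fg; apply: ae_eq_Rintegral => //.
- by apply: measurable_funM => //; exact: measurable_shift.
- by apply: measurable_funM => //; exact: measurable_shift.
by apply: filterS (ae_shift x fg) => y h /J_ge0 y0; rewrite h// addr_ge0.
Qed.

Lemma tr_step f a x : tr f (step a) x = \int[mu]_(y in `[0, a]) f (x + y).
Proof. exact: Rintegral_step. Qed.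

(** Agrees on the half-line with the product of [f] and [step a], but is written so as to be
    continuous on the whole line. *)
Definition window a f x : R :=
  \int[mu]_(y in `[0, x + a]) f y - \int[mu]_(y in `[0, x]) f y.

Lemma tr_window a f x : 0 <= a -> rL0 f -> 0 <= x ->
  tr f (step a) x = window a f x.
Proof.
by move=> a0 lf x0; rewrite tr_step; exact: (integral_window (rL0_locint lf)).
Qed.

Lemma rL0_window a f : 0 <= a -> rL0 f -> rL0 (window a f).
Proof.
move=> a0 lf; apply: rL0_ext (rL0_tr lf (rL1_step a)) => x x0.
exact: tr_window.
Qed.

Lemma continuous_window a f : rL0 f -> continuous (window a f).
Proof.
move=> lf x; have cf := continuous_primitive (rL0_locint lf).
apply: cvgB; last exact: cf.
apply: (@continuous_comp _ _ _ (fun x => x + a)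
  (fun x => \int[mu]_(y in `[0, x]) f y)); last exact: cf.
by apply: cvgD; [exact: cvg_id|exact: cvg_cst].
Qed.

End weighted_reals.

(** * The dual of L^1(w) *)

Section duality.
Context {R : realType} (w : weight R).
Notation mu := (@lebesgue_measure R).
Notation J := (`[0%R, +oo[%classic : set R).
Notation rL1 := (rL1 w).
Notation nrm1 := (nrm1 w).
Notation rbnd := (rbnd w).
Implicit Types (f g phi : R -> R) (X K : R) (S : set R).

(* Any positive function with [w * psi] integrable would do: it turns a bounded
   functional [la] on L^1(w) into the finite charge [S |-> la (psi * \1_S)]. *)
Definition psi x : R := expR (- x) * w x `^ (-1).

Lemma psiE x : 0 <= x -> w x * psi x = expR (- x).
Proof.
move=> x0; have w0 := weight_gt0 w x0.
by rewrite /psi powR_inv1 ?(ltW w0)// mulrC -mulrA mulVf ?mulr1// gt_eqF.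
Qed.

Lemma psi_gt0 x : 0 <= x -> 0 < psi x.
Proof. by move=> x0; rewrite mulr_gt0 ?expR_gt0// powR_gt0// weight_gt0. Qed.

Lemma measurable_psi : measurable_fun J psi.
Proof.
apply: measurable_funM.
  by apply: measurable_funTS; apply: measurableT_comp => //; exact: measurable_expR.
apply: (@measurable_comp _ _ _ _ _ _ setT (fun y : R => y `^ (-1)) J w) => //.
exact: measurable_weight.
Qed.

Lemma integrable_expRN : mu.-integrable J (EFin \o (fun x => expR (- x))).
Proof.
have h : mu.-integrable J (EFin \o exponential_pdf 1).
  exact: integrableS (integrable_exponential_pdf ltr01).
apply: eq_integrable h => // x; rewrite inE => /J_ge0 x0 /=.
by rewrite exponential_pdfE//= mul1r mulN1r.
Qed.

Lemma rL1_le theta phi : rL1 theta -> measurable_fun J phi ->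
  (forall x, 0 <= x -> `|phi x| <= `|theta x|) -> rL1 phi.
Proof.
move=> ltheta mphi le; split => //.
apply: (@integrable_ae_le _ _ _ (fun x => w x * `|theta x|)) => //.
- by apply: measurable_funM => //; exact: measurable_weight.
- exact: integrable_wnorm.
- by move=> x /J_ge0 x0; rewrite mulr_ge0// ltW// weight_gt0.
- apply: ae_of_J => x x0; rewrite normrM (ger0_norm (ltW (weight_gt0 w x0))).
  by rewrite ler_wpM2l ?le// ltW// weight_gt0.
Qed.

(** The functional is given on all functions and constrained on L^1(w) only; its independence of the
    representative is a consequence of the bound. *)
Definition bounded_L1 (la : (R -> R) -> R) K :=
  (forall a phi chi, rL1 phi -> rL1 chi ->
    la (fun x => a * phi x + chi x) = a * la phi + la chi) /\
  (forall phi, rL1 phi -> `|la phi| <= K * nrm1 phi).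

(** Dominated convergence makes the norms of [phi_ n - phi] tend to 0, and [la] is continuous for
    that norm. It serves both for sigma-additivity and for approximation by simple functions. *)
Lemma bounded_L1_cvg la K theta (phi_ : nat -> R -> R) phi :
  bounded_L1 la K -> rL1 theta -> (forall n, measurable_fun J (phi_ n)) ->
  (forall n x, 0 <= x -> `|phi_ n x| <= `|theta x|) ->
  (forall x, 0 <= x -> phi_ ^~ x @ \oo --> phi x) ->
  rL1 phi /\ la (phi_ n) @[n --> \oo] --> la phi.
Proof.
move=> [lin bnd] ltheta mphi le cv.
have lphi n : rL1 (phi_ n) by exact: rL1_le (le n).
have mlim : measurable_fun J phi.
  by apply: (@measurable_fun_cvg _ _ _ _ phi_) => // x /J_ge0; exact: cv.
have le' x : 0 <= x -> `|phi x| <= `|theta x|.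
  move=> x0; have /cvg_norm cvn := cv x x0.
  rewrite -(cvg_lim _ cvn)//; apply: limr_le; first by apply/cvg_ex; exists `|phi x|.
  by apply: nearW => n; exact: le.
have lim : rL1 phi by exact: rL1_le le'.
split=> //.
have w0 x : 0 <= x -> 0 <= w x by move=> /(weight_gt0 w)/ltW.
have [] := @dominated_convergence _ _ _ mu J (measurable_itv _)
  (fun n => EFin \o (fun x => w x * phi_ n x)) (EFin \o (fun x => w x * phi x))
  (EFin \o (fun x => w x * `|theta x|)).
- by move=> n; have [_] := lphi n; exact: measurable_int.
- by have [_] := lim; exact: measurable_int.
- apply: ae_of_J => x x0 /=; apply/fine_cvgP; split; first exact: nearW.
  by apply: cvgM; [exact: cvg_cst|exact: cv].
- exact: integrable_wnorm.
- apply: aeW => x n /J_ge0 x0 /=.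
  by rewrite lee_fin normrM ger0_norm ?w0// ler_wpM2l ?w0// le.
move=> _ cv0 _.
have {}cv0 : nrm1 (fun x => -1 * phi x + phi_ n x) @[n --> \oo] --> 0.
  have /fine_cvgP[_] := cv0; apply: cvg_trans; apply: near_eq_cvg; apply: nearW => n.
  congr fine; apply: eq_integral => x; rewrite inE => /J_ge0 x0 /=.
  rewrite -mulrBr normrM ger0_norm ?w0//.
  by congr ((_ * `|_|)%:E); ring.
apply/subr_cvg0; apply: norm_cvg0.
apply: (@squeeze_cvgr _ _ _ _ (cst 0)
  (fun n => K * nrm1 (fun x => -1 * phi x + phi_ n x))).
- apply: nearW => n; rewrite normr_ge0/=.
  have -> : la (phi_ n) - la phi = la (fun x => -1 * phi x + phi_ n x).
    by rewrite lin//; ring.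
  by apply: bnd; exact: rL1_lin.
- exact: cvg_cst.
- by rewrite -[X in _ --> X](mulr0 K); apply: cvgM cv0; exact: cvg_cst.
Qed.

Lemma bounded_L1_ext la K phi chi : bounded_L1 la K -> rL1 phi -> rL1 chi ->
  (forall x, 0 <= x -> phi x = chi x) -> la phi = la chi.
Proof.
move=> [lin bnd] lp lc e; apply/eqP; rewrite -subr_eq0 -normr_le0.
have -> : la phi - la chi = la (fun x => -1 * chi x + phi x) by rewrite lin//; ring.
apply: le_trans (bnd _ (rL1_lin _ lc lp)) _.
suff -> : nrm1 (fun x => -1 * chi x + phi x) = 0 by rewrite mulr0.
rewrite -(Rintegral_set0 mu (fun x => 0)) /nrm1.
rewrite [RHS]/Rintegral integral_set0 /Rintegral; congr fine; apply: integral0_eq.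
by move=> x /J_ge0 x0; rewrite e// mulN1r addNr normr0 mulr0.
Qed.

Lemma rL1_psi : rL1 psi.
Proof.
split; first exact: measurable_psi.
apply: eq_integrable integrable_expRN => // x; rewrite inE => /J_ge0 x0 /=.
by rewrite psiE.
Qed.

Lemma rL1_indic S phi : measurable S -> rL1 phi -> rL1 (fun x => phi x * \1_S x).
Proof.
move=> mS lphi; have [mphi _] := lphi; apply: (rL1_le lphi).
  by apply: measurable_funM => //; exact: measurable_indic.
move=> x _; rewrite normrM ler_piMr//.
by rewrite indicE; case: (_ \in _); rewrite ?normr1 ?normr0.
Qed.

Lemma Rintegral_indic f S : S `<=` J ->
  \int[mu]_(x in J) (f x * \1_S x) = \int[mu]_(x in S) f x.
Proof.
move=> SJ; rewrite -[in RHS](setIidr SJ) Rintegral_mkcondr.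
apply: eq_Rintegral => x _.
by rewrite patchE indicE; case: ifP; rewrite ?mulr1 ?mulr0.
Qed.

(** Testing on the set [S] of points beyond [X] where [g > K w]: there [(g - K w) psi] is positive,
    yet its integral is at most 0, so [S] is a null set. *)
Lemma ub_of_test X K g : 0 <= X -> measurable_fun J g ->
  mu.-integrable J (EFin \o (fun x => g x * psi x)) ->
  (forall S, measurable S -> S `<=` `[X, +oo[ ->
    \int[mu]_(x in S) (g x * psi x) <= K * \int[mu]_(x in S) (w x * psi x)) ->
  \forall x \ae mu, X <= x -> g x <= K * w x.
Proof.
move=> X0 mg ig test.
have mh : measurable_fun J (fun x => g x - K * w x).
  apply: measurable_funB => //; apply: measurable_funM => //.
  exact: measurable_weight.
pose S := `[X, +oo[ `&` (J `&` (fun x => g x - K * w x) @^-1` `]0, +oo[).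
have mS : measurable S by apply: measurableI => //; exact: mh.
have SX : S `<=` `[X, +oo[ by move=> x [].
have SJ : S `<=` J by move=> x [_ []].
have ih : mu.-integrable S (EFin \o (fun x => (- K) * (w x * psi x) + g x * psi x)).
  apply: integrable_lin => //; [|exact: integrableS ig].
  by have [_ ip] := rL1_psi; exact: integrableS ip.
have h0 x : S x -> 0 < (- K) * (w x * psi x) + g x * psi x.
  move=> [_ [/J_ge0 x0 /=]]; rewrite in_itv/= andbT => gK.
  by rewrite mulrA -mulrDl addrC mulNr mulr_gt0// psi_gt0.
have int0 : \int[mu]_(x in S) ((- K) * (w x * psi x) + g x * psi x) = 0.
  apply/eqP; rewrite eq_le; apply/andP; split; last first.
    by apply: Rintegral_ge0 => x /h0/ltW.
  rewrite Rintegral_lin//; last 2 first.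
  - by have [_ ip] := rL1_psi; exact: integrableS ip.
  - exact: integrableS ig.
  by have := test S mS SX; lra.
have : ae_eq mu S (EFin \o (fun x => (- K) * (w x * psi x) + g x * psi x)) (cst 0%E).
  apply/ae_eq_integral_abs => //; first exact: measurable_int ih.
  rewrite -[RHS]/(0%R%:E) -int0 /Rintegral fineK; last exact: integrable_fin_num.
  by apply: eq_integral => x; rewrite inE => /h0/ltW x0; rewrite gee0_abs.
move=> [N [mN N0 hN]]; exists N; split=> // x /= nx; apply: hN => /= xS.
apply: nx => Xx; rewrite leNgt; apply/negP => gx.
have Sx : S x.
  have x0 := le_trans X0 Xx.
  split; first by rewrite /= in_itv/= Xx.
  by split; [exact/J_ge0|rewrite /= in_itv/= andbT subr_gt0].
by have := xS Sx; have := h0 x Sx => /= + [e]; rewrite e ltxx.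
Qed.

Lemma rbnd_of_test X K g : 0 <= X -> measurable_fun J g ->
  mu.-integrable J (EFin \o (fun x => g x * psi x)) ->
  (forall S, measurable S -> S `<=` `[X, +oo[ ->
    `|\int[mu]_(x in S) (g x * psi x)| <= K * \int[mu]_(x in S) (w x * psi x)) ->
  rbnd X K g.
Proof.
move=> X0 mg ig test.
have up : \forall x \ae mu, X <= x -> g x <= K * w x.
  apply: ub_of_test => // S mS SX.
  by apply: le_trans (test S mS SX); exact: ler_norm.
have lo : \forall x \ae mu, X <= x -> - g x <= K * w x.
  apply: (@ub_of_test X K (fun x => - g x)) => //.
  - exact: measurableT_comp.
  - have := @integrableN _ _ _ mu J _ ig.
    by apply: eq_integrable => // x _ /=; rewrite mulNr.
  - move=> S mS SX; apply: le_trans (test S mS SX).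
    have SJ : S `<=` J.
      by move=> x /SX/=; rewrite !in_itv/= !andbT; exact: le_trans.
    have -> : \int[mu]_(x in S) (- g x * psi x) = - \int[mu]_(x in S) (g x * psi x).
      rewrite -mulN1r -RintegralZl//; last exact: integrableS ig.
      by apply: eq_Rintegral => x _; ring.
    by rewrite -normrN ler_norm.
apply: filterS2 up lo.
move=> x h1 h2 Xx.
by rewrite ler_norml; have := h1 Xx; have := h2 Xx; lra.
Qed.

End duality.

(** * Bounded functionals on L^1(w) are integrals against a function *)

Section L1_dual.
Import HBNNSimple.
Context {R : realType} (w : weight R).
Notation mu := (@lebesgue_measure R).
Notation J := (`[0%R, +oo[%classic : set R).
Notation rL1 := (rL1 w).
Notation nrm1 := (nrm1 w).
Notation rbnd := (rbnd w).
Notation psi := (psi w).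
Implicit Types (f g phi : R -> R) (X K : R) (S : set R).

Lemma nrm1_indic phi S : S `<=` J ->
  nrm1 (fun x => phi x * \1_S x) = \int[mu]_(x in S) (w x * `|phi x|).
Proof.
move=> SJ; rewrite -Rintegral_indic//; apply: eq_Rintegral => x _.
by rewrite normrM mulrA; congr (_ * _); rewrite indicE normr_nat.
Qed.

Lemma bounded_L1_0 (la : (R -> R) -> R) K : bounded_L1 w la K -> la (fun=> 0) = 0.
Proof.
move=> [lin _]; have l0 : rL1 (fun=> 0).
  apply: (rL1_le (rL1_psi w)); first exact: measurable_cst.
  by move=> x _; rewrite normr0.
transitivity (la (fun=> -1 * 0 + 0)); last by rewrite lin//; ring.
by congr la; apply/funext => x; ring.
Qed.

(** Sigma-additivity is [bounded_L1_cvg] along partial unions, dominated by [psi]; absolute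
    continuity holds because [psi * \1_S] has norm 0 when [S] is null. *)
Lemma bounded_L1_charge (la : (R -> R) -> R) K : bounded_L1 w la K ->
  exists g, [/\ measurable_fun setT g, mu.-integrable setT (EFin \o g) &
    forall S, measurable S ->
      la (fun x => psi x * \1_S x) = \int[mu]_(x in S) g x].
Proof.
move=> bla; have [lin bnd] := bla.
have lpsi := rL1_psi w; have [mpsi _] := lpsi.
pose nu (S : set (measurableTypeR R)) : \bar R :=
  (la (fun x => psi x * \1_S x))%:E.
have nu0 : nu set0 = 0%E.
  rewrite /nu; congr _%:E; rewrite -[RHS](bounded_L1_0 bla); congr la.
  by apply/funext => x; rewrite indicE in_set0 mulr0.
have nufin S : measurable S -> nu S \is a fin_num by [].
have nusig : semi_sigma_additive nu.
  move=> F mF tF mUF.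
  pose U n := \bigcup_(i in `I_n) F i.
  have mU n : measurable (U n) by apply: bigcup_measurable => i _; exact: mF.
  have sumE n : (\sum_(0 <= i < n) nu (F i) = nu (U n))%E.
    elim: n => [|n IH].
      by rewrite big_nil /U II0 bigcup_set0 nu0.
    rewrite big_nat_recr//= IH /nu -EFinD; congr _%:E.
    have := lin 1 _ _ (rL1_indic (mU n) lpsi) (rL1_indic (mF n) lpsi).
    rewrite mul1r => <-; congr la; apply/funext => x.
    rewrite mul1r -mulrDr; congr (_ * _).
    have -> : U n.+1 = U n `|` F n.
      apply/seteqP; split => y.
        move=> [i /= iS Fi]; move: iS; rewrite ltnS leq_eqVlt => /orP[/eqP <-|].
          by right.
        by move=> ?; left; exists i.
      move=> [[i /= iS Fi]|Fn]; last by exists n => //=.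
      by exists i => //=; exact: ltnW.
    rewrite !indicE in_setU; have [Ux|//] := boolP (x \in U n); last first.
      by rewrite add0r.
    have [Fx|_] := boolP (x \in F n); last by rewrite addr0.
    move: Ux Fx; rewrite !inE => -[i /= ilt Fi] Fn.
    by move: (tF i n I I (ex_intro _ x (conj Fi Fn))) ilt => ->; rewrite ltnn.
  under eq_fun do rewrite sumE.
  rewrite /nu; apply: cvg_EFin; first exact: nearW.
  have h1 n : measurable_fun J (fun x => psi x * \1_(U n) x).
    by have [] := rL1_indic (mU n) lpsi.
  have h2 n x : 0 <= x -> `|psi x * \1_(U n) x| <= `|psi x|.
    move=> _; rewrite normrM ler_piMr//.
    by rewrite indicE normr_nat; case: (_ \in _).
  have h3 x : 0 <= x ->
      (fun n => psi x * \1_(U n) x) @ \oo --> psi x * \1_(\bigcup_n F n) x.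
    move=> x0; apply: cvgM; first exact: cvg_cst.
    have [/set_mem[i _ Fi]|nF] := boolP (x \in \bigcup_n F n).
      apply: cvg_near_cst; exists i.+1 => // n /= ni.
      by rewrite !indicE !mem_set//; exists i.
    apply: cvg_near_cst; apply: nearW => n; rewrite !indicE.
    rewrite (negbTE nF) memNset// => -[i _ Fi].
    by move/negP: nF; apply; rewrite inE; exists i.
  by have [_] := bounded_L1_cvg bla lpsi h1 h2 h3.
pose nuC : {charge set (measurableTypeR R) -> \bar R} :=
  HB.pack nu (isCharge.Build _ _ _ nu nu0 nufin nusig).
have dom : nuC `<< mu.
  move=> N N0 A mA AN; rewrite /= /nu; congr _%:E.
  apply/eqP; rewrite -normr_le0.
  apply: le_trans (bnd _ (rL1_indic mA lpsi)) _.
  rewrite (_ : nrm1 _ = 0) ?mulr0//.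
  transitivity (\int[mu]_(x in J) (cst (0 : R) x)); last first.
    by rewrite Rintegral_cst ?mul0r.
  apply: ae_eq_Rintegral => //.
    have := integrable_wnorm (rL1_indic mA lpsi).
    by move=> /(measurable_int _)/measurable_EFinP.
  exists A; split=> //; first exact: N0.
  move=> x /= nx; apply: contrapT => nA; apply: nx => _.
  by rewrite indicE memNset// mulr0 normr0 mulr0.
pose f := Radon_Nikodym nuC mu.
have ffin x : f x \is a fin_num := Radon_Nikodym_fin_num x dom.
have fE x : EFin (fine (f x)) = f x.
  exact: fineK.
have fint : mu.-integrable setT (EFin \o (fun x => fine (f x))).
  apply: eq_integrable (Radon_Nikodym_integrable dom) => // x _ /=.
  by rewrite fE.
exists (fun x => fine (f x)); split => //.
- by have /measurable_EFinP := measurable_int _ fint.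
- move=> S mS; apply: EFin_inj; rewrite -[LHS]/(nuC S).
  rewrite (Radon_Nikodym_integral dom mS) /Rintegral fineK.
    by apply: eq_integral => x _; rewrite fE.
  apply: integrable_fin_num => //; exact: integrableS fint.
Qed.

Lemma integral_pair_bounded g K : 0 <= K -> measurable_fun J g -> rbnd 0 K g ->
  bounded_L1 w (fun phi => \int[mu]_(x in J) (g x * phi x)) K.
Proof.
move=> K0 mg bg; split => [a phi chi lphi lchi|phi lphi].
  rewrite -Rintegral_lin//; last 2 first.
  - by have [] := pair_le mg K0 bg lphi.
  - by have [] := pair_le mg K0 bg lchi.
  by apply: eq_Rintegral => x _; ring.
by have [] := pair_le mg K0 bg lphi.
Qed.

Lemma rL1_sum n (c : 'I_n -> R) (phi : 'I_n -> R -> R) :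
  (forall i, rL1 (phi i)) -> rL1 (fun x => \sum_(i < n) c i * phi i x).
Proof.
elim: n c phi => [|n IH] c phi lphi.
  apply: (rL1_le (rL1_psi w)) => [|x x0].
    rewrite (_ : (fun x => _) = cst 0); first exact: measurable_cst.
    by apply/funext => y; rewrite big_ord0.
  by rewrite big_ord0 normr0.
under eq_fun do rewrite big_ord_recl.
by apply: rL1_lin => //; exact: IH.
Qed.

Lemma bounded_L1_sum la K n (c : 'I_n -> R) (phi : 'I_n -> R -> R) :
  bounded_L1 w la K -> (forall i, rL1 (phi i)) ->
  la (fun x => \sum_(i < n) c i * phi i x) = \sum_(i < n) c i * la (phi i).
Proof.
move=> bla; have [lin _] := bla; elim: n c phi => [|n IH] c phi lphi.
  rewrite big_ord0 -[RHS](bounded_L1_0 bla); congr la; apply/funext => x.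
  by rewrite big_ord0.
under eq_fun do rewrite big_ord_recl.
by rewrite lin//; [rewrite big_ord_recl IH|exact: rL1_sum].
Qed.

(** A nonnegative [phi] is [psi * q] with [q] an increasing limit of simple functions, and on [psi]
    times a simple function the two functionals agree by linearity. *)
Lemma bounded_L1_eq la la' K K' : bounded_L1 w la K -> bounded_L1 w la' K' ->
  (forall S, measurable S ->
    la (fun x => psi x * \1_S x) = la' (fun x => psi x * \1_S x)) ->
  forall phi, rL1 phi -> la phi = la' phi.
Proof.
move=> bla bla' eqla.
have pos phi : rL1 phi -> (forall x, 0 <= x -> 0 <= phi x) -> la phi = la' phi.
  move=> lphi phi0; have [mphi _] := lphi.
  (* On the half-line [w x * expR x] is the inverse of [psi x], so this is [phi / psi]. *)
  pose q x := (phi x * (w x * expR x))%:E.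
  have mJ : measurable J by exact: measurable_itv.
  have mq : measurable_fun J q.
    apply/measurable_EFinP; apply: measurable_funM => //.
    by apply: measurable_funM; [exact: measurable_weight|exact: measurable_funTS].
  have q0 x : J x -> (0 <= q x)%E.
    move=> /J_ge0 x0; rewrite lee_fin mulr_ge0 ?phi0// mulr_ge0 ?expR_ge0//.
    exact/ltW/weight_gt0.
  have qpsi x : 0 <= x -> phi x * (w x * expR x) * psi x = phi x.
    move=> x0; rewrite -mulrA mulrAC (psiE w x0) -expRD.
    by rewrite addNr expR0 mulr1.
  pose s := nnsfun_approx mJ mq.
  have h1 n : measurable_fun J (fun x => psi x * s n x).
    apply: measurable_funM; [exact: measurable_psi|exact: measurable_funTS].
  have h2 n x : 0 <= x -> `|psi x * s n x| <= `|phi x|.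
    move=> x0; have px := psi_gt0 w x0.
    rewrite (ger0_norm (phi0 x x0)) ger0_norm; last by rewrite mulr_ge0// ltW.
    rewrite -[leRHS]qpsi// mulrC ler_pM2r// -lee_fin -/(q x).
    rewrite /s nnsfun_approxE; apply: le_approx => //; exact/J_ge0.
  have h3 x : 0 <= x -> (fun n => psi x * s n x) @ \oo --> phi x.
    move=> x0; rewrite -[X in _ --> X]qpsi// mulrC; apply: cvgM; first exact: cvg_cst.
    have /J_ge0 Jx := x0; have := cvg_nnsfun_approx mJ mq q0 Jx.
    by move=> /fine_cvgP[_].
  have [_ c1] := bounded_L1_cvg bla lphi h1 h2 h3.
  have [_ c2] := bounded_L1_cvg bla' lphi h1 h2 h3.
  apply: cvg_unique c1 _ => //; apply: cvg_trans c2; apply: near_eq_cvg.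
  apply: nearW => n.
  pose r : seq R := fset_set (range (s n)).
  have sE : (fun x => psi x * s n x) = (fun x => \sum_(i < size r)
      r`_i * (psi x * \1_(s n @^-1` [set r`_i]) x)).
    apply/funext => x; rewrite (fimfunEord (s n) x) mulr_sumr.
    by apply: eq_bigr => i _; ring.
  have lS (i : 'I_(size r)) : rL1 (fun x => psi x * \1_(s n @^-1` [set r`_i]) x).
    by apply: rL1_indic; [exact: measurable_sfunP|exact: rL1_psi].
  rewrite sE (bounded_L1_sum _ bla')// (bounded_L1_sum _ bla)//.
  apply: eq_bigr => i _; rewrite eqla//; exact: measurable_sfunP.
move=> phi lphi; have [mphi _] := lphi.
have lp : rL1 (fun x => Num.max (phi x) 0).
  apply: (rL1_le lphi) => [|x _]; first exact: measurable_maxr.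
  by rewrite /Num.max; case: ifP; rewrite ?normr0.
have ln : rL1 (fun x => Num.max (- phi x) 0).
  apply: (rL1_le lphi) => [|x _].
    by apply: measurable_maxr => //; exact: measurableT_comp.
  by rewrite /Num.max; case: ifP; rewrite ?normr0 ?normrN.
have -> : phi = (fun x => -1 * Num.max (- phi x) 0 + Num.max (phi x) 0).
  by apply/funext => x; rewrite /Num.max; do 2 case: ltP => ?; lra.
have [lin _] := bla; have [lin' _] := bla'.
by rewrite lin// lin'// !pos// => x _; rewrite le_max lexx orbT.
Qed.

(** The density of the charge is divided by [psi]. Estimating [la] on [psi * \1_S] bounds the
    quotient by [K w] with the same [K], and agreement on these functions extends to L^1(w). *)
Theorem L1_dual la K : 0 <= K -> bounded_L1 w la K ->
  exists g, [/\ measurable_fun J g, rbnd 0 K g &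
    forall phi, rL1 phi -> la phi = \int[mu]_(x in J) (g x * phi x)].
Proof.
move=> K0 bla; have [lin bnd] := bla.
have [f [mf intf fE]] := bounded_L1_charge bla.
pose g x := f x * (w x * expR x).
have gpsi x : 0 <= x -> g x * psi x = f x.
  by move=> x0; rewrite /g -mulrA mulrAC (psiE w x0) -expRD addNr expR0 mulr1.
have mg : measurable_fun J g.
  apply: measurable_funM; first exact: measurable_funTS.
  by apply: measurable_funM; [exact: measurable_weight|exact: measurable_funTS].
have intS S : measurable S -> S `<=` J ->
    \int[mu]_(x in S) (g x * psi x) = la (fun x => psi x * \1_S x).
  move=> mS SJ; rewrite fE//; apply: eq_Rintegral => x.
  by rewrite inE => /SJ/J_ge0; exact: gpsi.
have bg : rbnd 0 K g.
  apply: rbnd_of_test => //.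
    have : mu.-integrable J (EFin \o f) by exact: integrableS intf.
    by apply: eq_integrable => // x; rewrite inE => /J_ge0 x0 /=; rewrite gpsi.
  move=> S mS SJ; rewrite intS//.
  apply: le_trans (bnd _ (rL1_indic mS (rL1_psi w))) _.
  rewrite nrm1_indic// ler_wpM2l// le_eqVlt; apply/orP; left; apply/eqP.
  apply: eq_Rintegral => x.
  by rewrite inE => /SJ/J_ge0 x0; rewrite ger0_norm// ltW// psi_gt0.
exists g; split => //.
apply: (bounded_L1_eq bla (integral_pair_bounded K0 mg bg)) => S mS.
have mSJ : measurable (S `&` J) by exact: measurableI.
rewrite (@bounded_L1_ext _ w la K _
  (fun x => psi x * \1_(S `&` J) x) bla); last 3 first.
- exact: rL1_indic (rL1_psi w).
- exact: rL1_indic (rL1_psi w).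
- move=> x x0; rewrite !indicE in_setI; congr (_ * _%:R).
  by rewrite (_ : x \in J) ?andbT//; apply/mem_set/J_ge0.
rewrite -intS//.
rewrite Rintegral_mkcondl; apply: eq_Rintegral => x _.
by rewrite patchE indicE mulrA; case: ifP; rewrite ?mulr1 ?mulr0.
Qed.

End L1_dual.

(** * The action of the dual on L_0^oo(w) *)

Section complex_L0inf.
Context {R : realType} (w : weight R).
Notation mu := (@lebesgue_measure R).
Notation rL0 := (rL0 w).
Notation rbnd := (rbnd w).
Notation Re := complex.Re.
Notation Im := complex.Im.
Notation in_L0inf := (in_L0inf w).
Notation cls := (L0inf_class w).
Implicit Types (f g : R -> R[i]) (F G : L0inf w) (X M : R).

Lemma normc_ge0 (z : R[i]) : 0 <= normc z.
Proof. by case: z => a b; exact: sqrtr_ge0. Qed.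

Lemma normc_geRe (z : R[i]) : `|Re z| <= normc z.
Proof. by case: z => a b /=; rewrite -sqrtr_sqr ler_wsqrtr// lerDl sqr_ge0. Qed.

Lemma normc_geIm (z : R[i]) : `|Im z| <= normc z.
Proof. by case: z => a b /=; rewrite -sqrtr_sqr ler_wsqrtr// lerDr sqr_ge0. Qed.

Lemma normc_le (z : R[i]) : normc z <= `|Re z| + `|Im z|.
Proof.
case: z => a b /=; rewrite -(ger0_norm (addr_ge0 (normr_ge0 a) (normr_ge0 b))).
rewrite -sqrtr_sqr ler_wsqrtr// sqrrD !real_normK ?num_real// -addrA lerD2l.
by rewrite lerDr mulrn_wge0// mulr_ge0.
Qed.

Lemma ae_mrestr (I : interval R) (P : R -> Prop) :
  (\forall x \ae mrestr mu (measurable_itv I), P x) <->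
  (\forall x \ae mu, x \in I -> P x).
Proof.
split=> -[N [mN N0 NP]].
  exists (N `&` [set` I]); split => //; first exact: measurableI.
  move=> x /= /not_implyP[Ix nP]; split=> //; exact: NP.
exists (N `|` ~` [set` I]); split.
- by apply: measurableU => //; exact: measurableC.
- rewrite /mrestr setIUl setICl setU0; apply: subset_measure0 N0 => //.
  exact: measurableI.
- move=> x /= nP; have [Ix|] := pselect (x \in I); last by right.
  by left; apply: NP => /= /(_ Ix).
Qed.

Lemma ess_sup_itv_leP b X f M : 0 <= X ->
  (ess_sup_itv (Interval (BSide b X) +oo%O) (wratio w f) <= M%:E)%E <->
  (\forall x \ae mu, x \in Interval (BSide b X) +oo%O -> normc (f x) <= M * w x).
Proof.
move=> X0; have pos x : x \in Interval (BSide b X) +oo%O -> 0 < w x.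
  rewrite in_itv/= andbT => Xx; apply: weight_gt0.
  by case: b Xx => [|/ltW]; exact: le_trans.
split=> [/ess_supP/ae_mrestr|h].
  apply: filterS.
  by move=> x fx xI; move: (fx xI); rewrite lee_fin ler_pdivrMr// pos.
apply/ess_supP/ae_mrestr; apply: filterS h.
by move=> x fx xI; move: (fx xI); rewrite lee_fin ler_pdivrMr// pos.
Qed.

Definition cbnd X M f := \forall x \ae mu, X <= x -> normc (f x) <= M * w x.

Lemma cbnd_parts X M f : cbnd X M f ->
  rbnd X M (fun x => Re (f x)) /\ rbnd X M (fun x => Im (f x)).
Proof.
move=> h; split; apply: filterS h.
- by move=> x fx Xx; apply: le_trans (fx Xx); exact: normc_geRe.
- by move=> x fx Xx; apply: le_trans (fx Xx); exact: normc_geIm.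
Qed.

Lemma parts_cbnd X M N f : rbnd X M (fun x => Re (f x)) ->
  rbnd X N (fun x => Im (f x)) -> cbnd X (M + N) f.
Proof.
apply: filterS2.
move=> x fr fi Xx; apply: le_trans (normc_le _) _.
by rewrite mulrDl lerD ?fr ?fi.
Qed.

(** Each part is dominated by the modulus, and the modulus by the sum of the parts. Later statements
    on L_0^oo(w) are reduced in this way to real functions and a.e. bounds. *)
Lemma in_L0infP f : in_L0inf f <->
  rL0 (fun x => Re (f x)) /\ rL0 (fun x => Im (f x)).
Proof.
split=> [[[mr mi] fin tail]|[[mr [M M0 bM] tr] [mi [N N0 bN] ti]]].
  have [M M0 bM] : exists2 M, 0 <= M & cbnd 0 M f.
    have ge0 := Defs.ess_sup_wratio_ge0 w true f (lexx 0).
    exists (fine (ess_sup_itv `[0, +oo[ (wratio w f))); first exact: fine_ge0.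
    have := lexx (ess_sup_itv `[0, +oo[ (wratio w f)).
    rewrite -[X in (_ <= X)%E -> _]fineK ?ge0_fin_numE//.
    move=> /(ess_sup_itv_leP true f _ (lexx 0)).
    apply: filterS.
    by move=> x fx x0; apply: fx; rewrite in_itv/= x0.
  have {}tail e : 0 < e -> exists2 X, 0 <= X & cbnd X e f.
    move=> e0.
    have : \forall x \near +oo, (ess_sup_itv `]x, +oo[ (wratio w f) < e%:E)%E.
      move/fine_cvgP : tail => [fint /cvgrPdist_lt/(_ e e0)].
      apply: filterS2 fint => x fx; rewrite sub0r normrN => h.
      by rewrite -(fineK fx) lte_fin; apply: le_lt_trans h; exact: ler_norm.
    move=> near_e.
    have [X X0 Xe] : exists2 X, 0 <= X & (ess_sup_itv `]X, +oo[ (wratio w f) < e%:E)%E.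
      near (+oo_R) => X; exists X; near: X; [exact: nbhs_pinfty_ge|exact: near_e].
    (* The essential supremum is taken over the open half-line []X, +oo[], whereas [cbnd] includes
       its endpoint. *)
    exists (X + 1); first by rewrite addr_ge0.
    move/ltW: Xe => /(ess_sup_itv_leP false f _ X0).
    apply: filterS.
    move=> x fx x0; apply: fx; rewrite in_itv/= andbT.
    by apply: lt_le_trans x0; rewrite ltrDl.
  have [bMr bMi] := cbnd_parts bM.
  split; split => //; try by exists M.
    by move=> e /tail[X X0 /cbnd_parts[]]; exists X.
  by move=> e /tail[X X0 /cbnd_parts[]]; exists X.
split; first by split.
  apply: (@le_lt_trans _ _ (M + N)%:E); last exact: ltry.
  apply/(ess_sup_itv_leP true f _ (lexx 0)); have := parts_cbnd bM bN.
  apply: filterS.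
  by move=> x fx; rewrite in_itv/= andbT; exact: fx.
have tail e : 0 < e -> \forall x \near +oo,
    (0 <= ess_sup_itv `]x, +oo[ (wratio w f) <= e%:E)%E.
  move=> e0; have e2 : 0 < e / 2 by rewrite divr_gt0.
  have [X X0 bX] := tr _ e2; have [Y Y0 bY] := ti _ e2.
  near=> x.
  have Xx : X <= x by near: x; apply: nbhs_pinfty_ge; rewrite num_real.
  have Yx : Y <= x by near: x; apply: nbhs_pinfty_ge; rewrite num_real.
  have x0 : 0 <= x by exact: le_trans Xx.
  rewrite (Defs.ess_sup_wratio_ge0 w false f x0)/=.
  apply/(ess_sup_itv_leP false f _ x0).
  have := parts_cbnd (rbnd_le x0 Xx (lexx _) bX) (rbnd_le x0 Yx (lexx _) bY).
  apply: filterS.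
  by move=> z fz; rewrite in_itv/= andbT => /ltW/fz; rewrite -splitr.
apply/fine_cvgP; split.
  apply: filterS (tail 1 ltr01) => x /andP[h0 h1].
  by rewrite ge0_fin_numE// (le_lt_trans h1) ?ltry.
apply/cvgrPdist_le => e e0; apply: filterS (tail e e0) => x /andP[h0 h1] /=.
rewrite sub0r normrN ger0_norm ?fine_ge0// -lee_fin fineK//.
by rewrite ge0_fin_numE// (le_lt_trans h1) ?ltry.
Unshelve. all: by end_near. Qed.

Lemma in_L0inf_lin a f g : in_L0inf f -> in_L0inf g ->
  in_L0inf (fun x => a * f x + g x).
Proof.
move=> lf lg; have [_ /(_ a f g)] := L0inf_pred_submod_closed w.
by move=> /(_ (asboolT lf) (asboolT lg))/asboolP.
Qed.

Lemma in_L0inf_repr F : in_L0inf (repr F).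
Proof. by apply/asboolP; case: (repr F). Qed.

Lemma cls_repr F : cls (repr F) = F.
Proof. by rewrite /L0inf_class valKd reprK. Qed.

Lemma repr_cls f : in_L0inf f -> \forall x \ae mu, 0 <= x -> repr (cls f) x = f x.
Proof.
move=> lf; have := Defs.repr_ae (insubd (0 : L0inf_fun w) f).
apply: filterS.
by move=> x h x0; rewrite h// insubdK//; exact/asboolP.
Qed.

Lemma cls_ext f g : in_L0inf f -> in_L0inf g ->
  (\forall x \ae mu, 0 <= x -> f x = g x) -> cls f = cls g.
Proof.
move=> lf lg fg; apply/(@eqquotP _ (@ae_eqb _ w) (L0inf w))/asboolP.
apply: filterS fg.
by move=> x fg x0; rewrite !insubdK ?fg//; exact/asboolP.
Qed.

Lemma cls_lin a f g : in_L0inf f -> in_L0inf g ->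
  cls (fun x => a * f x + g x) = a *: cls f + cls g.
Proof.
move=> lf lg.
have -> : a *: cls f + cls g = \pi_(L0inf w)
    (a *: insubd (0 : L0inf_fun w) f + insubd (0 : L0inf_fun w) g).
  rewrite -(Defs.L0inf_pi_add (a *: _)) -(Defs.L0inf_pi_scale a); reflexivity.
congr (\pi_(L0inf w) _); apply: val_inj.
have lfg := in_L0inf_lin a lf lg.
rewrite insubdK; last exact/asboolP.
change ((fun x => a * f x + g x) = a *: val (insubd (0 : L0inf_fun w) f) +
  val (insubd (0 : L0inf_fun w) g)).
by rewrite !insubdK//; exact/asboolP.
Qed.

Lemma L0inf_norm_bnd F : 0 <= L0inf_norm F /\ cbnd 0 (L0inf_norm F) (repr F).
Proof.
have [_ fin _] := in_L0inf_repr F.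
have ge0 := Defs.ess_sup_wratio_ge0 w true (repr F) (lexx 0).
split; first exact: fine_ge0.
have := lexx (ess_sup_itv `[0, +oo[ (wratio w (repr F))).
rewrite -[X in (_ <= X)%E -> _]fineK ?ge0_fin_numE//.
move=> /(ess_sup_itv_leP true (repr F) _ (lexx 0)).
apply: filterS.
by move=> x fx x0; apply: fx; rewrite in_itv/= x0.
Qed.

Lemma L0inf_norm_le F M : cbnd 0 M (repr F) -> L0inf_norm F <= M.
Proof.
move=> b; have [_ fin _] := in_L0inf_repr F.
have ge0 := Defs.ess_sup_wratio_ge0 w true (repr F) (lexx 0).
rewrite -lee_fin fineK ?ge0_fin_numE//.
apply/(ess_sup_itv_leP true (repr F) _ (lexx 0)).
apply: filterS b.
by move=> x fx; rewrite in_itv/= andbT; exact: fx.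
Qed.

Lemma dual_lin (n : dual w) a F G : n (a *: F + G) = a * n F + n G.
Proof. by case: n => n /= /asboolP[lin _]; exact: lin. Qed.

Lemma dual_bounded (n : dual w) : exists2 c, 0 <= c &
  forall f M, in_L0inf f -> cbnd 0 M f -> normc (n (cls f)) <= c * M.
Proof.
(* The constant supplied by [dual_pred] carries no sign, hence the absolute value. *)
case: n => n /= /asboolP[_ [c nc]]; exists `|c| => // f M lf bM.
have nM : L0inf_norm (cls f) <= M.
  apply: L0inf_norm_le; apply: filterS2 (repr_cls lf) bM.
  by move=> x h1 h2 x0; rewrite h1// h2.
apply: le_trans (nc _) _; apply: (@le_trans _ _ (`|c| * L0inf_norm (cls f))).
  by rewrite ler_wpM2r ?ler_norm//; case: (L0inf_norm_bnd (cls f)).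
by rewrite ler_wpM2l.
Qed.

End complex_L0inf.

(** * Existence and computation of n F, and the Arens product *)

Section dual_action.
Context {R : realType} (w : weight R).
Notation mu := (@lebesgue_measure R).
Notation J := (`[0%R, +oo[%classic : set R).
Notation rL0 := (rL0 w).
Notation rL1 := (rL1 w).
Notation nrm1 := (nrm1 w).
Notation rbnd := (rbnd w).
Notation cbnd := (cbnd w).
Notation tr := (@tr R).
Notation Re := complex.Re.
Notation Im := complex.Im.
Notation in_L0inf := (in_L0inf w).
Notation cls := (L0inf_class w).
Notation "f *c phi" := (translate_integral f (fun y => (phi y)%:C)) (at level 40).
Implicit Types (f g : R -> R[i]) (F G : L0inf w) (X M : R) (phi : R -> R)
  (n : dual w).

Lemma translate_integralE f phi x :
  (f *c phi) x = tr (fun x => Re (f x)) phi x +i* tr (fun x => Im (f x)) phi x.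
Proof.
by congr (_ +i* _); apply: eq_Rintegral => y _; case: (f _) => a b /=; ring.
Qed.

Lemma Re_translate f phi :
  (fun x => Re ((f *c phi) x)) = tr (fun x => Re (f x)) phi.
Proof. by apply/funext => x; rewrite translate_integralE. Qed.

Lemma Im_translate f phi :
  (fun x => Im ((f *c phi) x)) = tr (fun x => Im (f x)) phi.
Proof. by apply/funext => x; rewrite translate_integralE. Qed.

Lemma Re_lin a (z z' : R[i]) : Re (a%:C * z + z') = a * Re z + Re z'.
Proof. by case: z z' => ? ? [? ?] /=; ring. Qed.

Lemma Im_lin a (z z' : R[i]) : Im (a%:C * z + z') = a * Im z + Im z'.
Proof. by case: z z' => ? ? [? ?] /=; ring. Qed.

Lemma complex_parts (z : R[i]) : Re z +i* Im z = z.
Proof. by case: z. Qed.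

Lemma in_L0inf_translate f phi : in_L0inf f -> rL1 phi -> in_L0inf (f *c phi).
Proof.
move=> /in_L0infP[fr fi] lphi; apply/in_L0infP; split.
  by rewrite Re_translate; exact: rL0_tr.
by rewrite Im_translate; exact: rL0_tr.
Qed.

Lemma in_L1_parts (phi : R -> R[i]) : in_L1 w phi ->
  rL1 (fun x => Re (phi x)) /\ rL1 (fun x => Im (phi x)).
Proof.
move=> [[mr mi] fin].
have w0 x : 0 <= x -> 0 <= w x by move=> /(weight_gt0 w)/ltW.
have part (u : R -> R) : measurable_fun J u ->
    (forall x, `|u x| <= normc (phi x)) -> rL1 u.
  move=> mu' le; split => //; have mw := measurable_weight w.
  apply/integrableP; split; first exact/measurable_EFinP/measurable_funM.
  apply: le_lt_trans fin; apply: ge0_le_integral => //=.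
  - apply/measurable_EFinP; apply: measurableT_comp => //; exact: measurable_funM.
  - apply/measurable_EFinP; apply: measurable_funM => //.
    rewrite (_ : (fun x => _) =
      (fun x => Num.sqrt (Re (phi x) ^+ 2 + Im (phi x) ^+ 2))).
      apply: measurableT_comp => //.
        by apply: continuous_measurable_fun; exact: sqrt_continuous.
      by apply: measurable_funD; exact: measurable_funX.
    by apply/funext => x; case: (phi x).
  - move=> x; rewrite inE => /J_ge0 x0.
    by rewrite lee_fin normrM ger0_norm ?w0// ler_wpM2l ?w0.
by split; apply: part => // x; [exact: normc_geRe|exact: normc_geIm].
Qed.

Lemma in_L1_real phi : rL1 phi -> in_L1 w (fun x => (phi x)%:C).
Proof.
move=> [mphi iphi]; split; first by split => //; exact: measurable_cst.
have /integrableP[_] := iphi; apply: le_lt_trans.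
rewrite le_eqVlt; apply/orP; left; apply/eqP; apply: eq_integral => x.
rewrite inE => /J_ge0 x0 /=; rewrite expr0n addr0 sqrtr_sqr normrM.
by rewrite (ger0_norm (ltW (weight_gt0 w x0))).
Qed.

(* When [phi] vanishes on [[0, Z[], the function [f phi] only involves the values
   of [f] beyond [Z]. *)
Lemma dual_translate_le n : exists2 c, 0 <= c &
  forall f phi Z N, in_L0inf f -> rL1 phi -> 0 <= Z -> 0 <= N -> cbnd Z N f ->
    (forall y, 0 <= y < Z -> phi y = 0) ->
    normc (n (cls (f *c phi))) <= c * N * nrm1 phi.
Proof.
(* The factor 2 pays for bounding the real and imaginary parts separately. *)
have [c c0 nc] := dual_bounded n; exists (c * 2); first by rewrite mulr_ge0.
move=> f phi Z N lf lphi Z0 N0 bf phiZ.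
have [bfr bfi] := cbnd_parts bf; have /in_L0infP[[mr _ _] [mi _ _]] := lf.
rewrite (_ : c * 2 * N * _ = c * (N * nrm1 phi + N * nrm1 phi)); last by ring.
apply: nc; first exact: in_L0inf_translate.
have h (u : R -> R) : measurable_fun J u -> rbnd Z N u ->
    rbnd 0 (N * nrm1 phi) (tr u phi).
  move=> mu' bu; apply: aeW => x x0.
  have phiZ' y : 0 <= y -> x + y < Z -> phi y = 0.
    by move=> y0 xyZ; apply: phiZ; rewrite y0/=; apply: le_lt_trans xyZ; rewrite lerDr.
  by have [_] := tr_le x0 Z0 N0 mu' bu lphi phiZ'; rewrite mulrAC.
by apply: parts_cbnd; rewrite ?Re_translate ?Im_translate; exact: h.
Qed.

Lemma dual_translate_lin n f a phi chi : in_L0inf f -> rL1 phi -> rL1 chi ->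
  n (cls (f *c (fun y => a * phi y + chi y))) =
  a%:C * n (cls (f *c phi)) + n (cls (f *c chi)).
Proof.
move=> lf lphi lchi.
have l1 := in_L0inf_translate lf lphi; have l2 := in_L0inf_translate lf lchi.
have <- := dual_lin n a%:C (cls (f *c phi)) (cls (f *c chi)).
have <- := cls_lin a%:C l1 l2.
apply: (congr1 (fun F : L0inf w => n F : R[i])); apply: cls_ext.
- exact: (in_L0inf_translate lf (rL1_lin a lphi lchi)).
- exact: (in_L0inf_lin a%:C l1 l2).
apply: aeW => x x0; have /in_L0infP[lr li] := lf.
rewrite !translate_integralE !(tr_linr (w := w))//.
by apply/eqP; rewrite eq_complex /=; apply/andP; split; apply/eqP; ring.
Qed.

Lemma dual_translate_bounded_L1 n F : exists2 K, 0 <= K &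
  bounded_L1 w (fun phi => Re (n (cls (repr F *c phi)))) K /\
  bounded_L1 w (fun phi => Im (n (cls (repr F *c phi)))) K.
Proof.
have [c c0 nc] := dual_translate_le n; have [F0 bF] := L0inf_norm_bnd F.
have lF := in_L0inf_repr F.
have bnd phi : rL1 phi ->
    normc (n (cls (repr F *c phi))) <= c * L0inf_norm F * nrm1 phi.
  move=> lphi; apply: (nc _ _ 0) => // y /andP[y0]; by rewrite ltNge y0.
exists (c * L0inf_norm F); first by rewrite mulr_ge0.
split; split => [a phi chi lphi lchi|phi lphi].
- have := congr1 (@complex.Re R) (dual_translate_lin n a lF lphi lchi).
  by rewrite Re_lin.
- exact: le_trans (normc_geRe _) (bnd _ lphi).
- have := congr1 (@complex.Im R) (dual_translate_lin n a lF lphi lchi).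
  by rewrite Im_lin.
- exact: le_trans (normc_geIm _) (bnd _ lphi).
Qed.

(** A converse of Hölder's inequality localized at infinity: an operator bound on the test functions
    vanishing before [X] is a pointwise bound beyond [X], as seen on [psi * \1_S] with [S] beyond
    [X]. *)
Lemma rbnd_of_pairing (u : R -> R) K (la : (R -> R) -> R) :
  measurable_fun J u -> 0 <= K -> rbnd 0 K u ->
  (forall phi, rL1 phi -> la phi = \int[mu]_(x in J) (u x * phi x)) ->
  forall X M, 0 <= X -> 0 <= M ->
  (forall phi, rL1 phi -> (forall y, 0 <= y < X -> phi y = 0) ->
    `|la phi| <= M * nrm1 phi) -> rbnd X M u.
Proof.
move=> mu' K0 bu laE X M X0 M0 le; apply: rbnd_of_test => //.
  by have [] := pair_le mu' K0 bu (rL1_psi w).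
move=> S mS SX.
have SJ : S `<=` J.
  by move=> x /SX/=; rewrite !in_itv/= !andbT; exact: le_trans.
have lS := rL1_indic mS (rL1_psi w).
have := le _ lS; rewrite laE// nrm1_indic//.
have -> : \int[mu]_(x in S) (w x * `|psi w x|) = \int[mu]_(x in S) (w x * psi w x).
  apply: eq_Rintegral => x; rewrite inE => /SJ/J_ge0 x0.
  by rewrite ger0_norm// ltW// psi_gt0.
have -> : \int[mu]_(x in J) (u x * (psi w x * \1_S x)) =
    \int[mu]_(x in S) (u x * psi w x).
  by rewrite -[RHS]Rintegral_indic//; apply: eq_Rintegral => x _; rewrite mulrA.
apply => y /andP[y0 yX]; rewrite indicE memNset ?mulr0// => /SX/=.
by rewrite in_itv/= andbT leNgt yX.
Qed.

(** [L1_dual] only yields parts bounded by a multiple of [w]. Decay at infinity comes from test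
    functions vanishing before [X]: they see only the tail of [F], where [F / w] is small. *)
Lemma dual_density n F : exists g, in_L0inf g /\ forall phi, rL1 phi ->
  n (cls (repr F *c phi)) =
  \int[mu]_(x in J) (Re (g x) * phi x) +i* \int[mu]_(x in J) (Im (g x) * phi x).
Proof.
have [K K0 [br bi]] := dual_translate_bounded_L1 n F.
have [u [mu' bu uE]] := L1_dual K0 br; have [v [mv bv vE]] := L1_dual K0 bi.
have [c c0 nc] := dual_translate_le n.
have lF := in_L0inf_repr F.
have tailF e : 0 < e -> exists2 X, 0 <= X & cbnd X e (repr F).
  have /in_L0infP[[_ _ tr] [_ _ ti]] := lF.
  move=> e0; have e2 : 0 < e / 2 by rewrite divr_gt0.
  have [X X0 bX] := tr _ e2; have [Y Y0 bY] := ti _ e2.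
  have XY0 : 0 <= Num.max X Y by rewrite le_max X0.
  exists (Num.max X Y) => //; rewrite (splitr e); apply: parts_cbnd.
  - by apply: (rbnd_le XY0 _ (lexx _) bX); rewrite le_max lexx.
  - by apply: (rbnd_le XY0 _ (lexx _) bY); rewrite le_max lexx orbT.
have tail e : 0 < e -> exists2 X, 0 <= X & rbnd X e u /\ rbnd X e v.
  move=> e0; have c1 : 0 < c + 1 by rewrite ltr_wpDl.
  have d0 := divr_gt0 e0 c1.
  have [X X0 bX] := tailF _ d0; exists X => //.
  have le phi : rL1 phi -> (forall y, 0 <= y < X -> phi y = 0) ->
      normc (n (cls (repr F *c phi))) <= e * nrm1 phi.
    move=> lphi phiX; apply: le_trans (nc _ _ _ _ lF lphi X0 (ltW d0) bX phiX) _.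
    rewrite ler_wpM2r ?nrm1_ge0// mulrCA ler_piMr ?ltW//.
    by rewrite ltr_pdivrMr// mul1r ltrDl.
  split.
    apply: (rbnd_of_pairing mu' K0 bu uE X0 (ltW e0)) => phi lphi phiX.
    exact: le_trans (normc_geRe _) (le _ lphi phiX).
  apply: (rbnd_of_pairing mv K0 bv vE X0 (ltW e0)) => phi lphi phiX.
  exact: le_trans (normc_geIm _) (le _ lphi phiX).
exists (fun x => u x +i* v x); split.
  apply/in_L0infP; split; split=> //; try by exists K.
    by move=> e /tail[X X0 []]; exists X.
  by move=> e /tail[X X0 []]; exists X.
by move=> phi lphi; rewrite /= -uE// -vE// complex_parts.
Qed.

Lemma in_L0inf_ext f g : (forall x, 0 <= x -> f x = g x) ->
  in_L0inf f -> in_L0inf g.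
Proof.
move=> e /in_L0infP[lr li]; apply/in_L0infP; split.
  by apply: rL0_ext lr => x x0; rewrite e.
by apply: rL0_ext li => x x0; rewrite e.
Qed.

Lemma cintegral_mul f (phi : R -> R[i]) : in_L0inf f -> in_L1 w phi ->
  cintegral J (fun x => f x * phi x) =
  (\int[mu]_(x in J) (Re (f x) * Re (phi x)) -
   \int[mu]_(x in J) (Im (f x) * Im (phi x))) +i*
  (\int[mu]_(x in J) (Re (f x) * Im (phi x)) +
   \int[mu]_(x in J) (Im (f x) * Re (phi x))).
Proof.
move=> /in_L0infP[lr li] /in_L1_parts[pr pi]; congr (_ +i* _).
  rewrite -RintegralB//; try exact: (rL0_pair (w := w)).
  by apply: eq_Rintegral => x _; case: (f x) => ? ?; case: (phi x).
rewrite -RintegralD//; try exact: (rL0_pair (w := w)).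
by apply: eq_Rintegral => x _; case: (f x) => ? ?; case: (phi x).
Qed.

Lemma translate_integral_parts f (phi : R -> R[i]) x : 0 <= x ->
  in_L0inf f -> in_L1 w phi ->
  translate_integral f phi x =
  'i * (f *c (fun y => Im (phi y))) x + (f *c (fun y => Re (phi y))) x.
Proof.
move=> x0 /in_L0infP[lr li] /in_L1_parts[pr pi].
rewrite !translate_integralE /translate_integral /cintegral.
have -> : \int[mu]_(y in J) Re (f (x + y) * phi y) =
    (-1) * tr (fun x => Im (f x)) (fun y => Im (phi y)) x +
    tr (fun x => Re (f x)) (fun y => Re (phi y)) x.
  rewrite /tr -Rintegral_lin//; last 2 first.
  - exact: (tr_integrable x0 li pi).
  - exact: (tr_integrable x0 lr pr).
  by apply: eq_Rintegral => y _; case: (f _) => ? ?; case: (phi y) => ? ? /=; ring.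
have -> : \int[mu]_(y in J) Im (f (x + y) * phi y) =
    1 * tr (fun x => Re (f x)) (fun y => Im (phi y)) x +
    tr (fun x => Im (f x)) (fun y => Re (phi y)) x.
  rewrite /tr -Rintegral_lin//; last 2 first.
  - exact: (tr_integrable x0 lr pi).
  - exact: (tr_integrable x0 li pr).
  by apply: eq_Rintegral => y _; case: (f _) => ? ?; case: (phi y) => ? ? /=; ring.
by apply/eqP; rewrite eq_complex /=; apply/andP; split; apply/eqP; ring.
Qed.

Lemma ae_eq_Rintegral_pair (u v phi : R -> R) : rL0 u -> rL0 v -> rL1 phi ->
  (\forall x \ae mu, 0 <= x -> u x = v x) ->
  \int[mu]_(x in J) (u x * phi x) = \int[mu]_(x in J) (v x * phi x).
Proof.
move=> [mu' _ _] [mv _ _] [mphi _] uv; apply: ae_eq_Rintegral => //.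
- exact: measurable_funM.
- exact: measurable_funM.
apply: filterS uv.
by move=> x uv /J_ge0 x0; rewrite uv.
Qed.

(** The density found for real test functions satisfies the complex condition that defines
    [dual_act], by complex linearity, so the default of [xget] is not reached. Real test functions
    are then all that is used. *)
Lemma dual_actP n F phi : rL1 phi ->
  n (cls (repr F *c phi)) =
  \int[mu]_(x in J) (Re (repr (dual_act n F) x) * phi x) +i*
  \int[mu]_(x in J) (Im (repr (dual_act n F) x) * phi x).
Proof.
have lF := in_L0inf_repr F.
have [g [lg gE]] := dual_density n F.
have ex : exists G : L0inf w, forall phi : R -> R[i], in_L1 w phi ->
    cintegral J (fun x => repr G x * phi x) =
    n (L0inf_class w (translate_integral (repr F) phi)).
  exists (cls g) => chi lchi; have [cr ci] := in_L1_parts lchi.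
  rewrite cintegral_mul//; last exact: in_L0inf_repr.
  have l1 := in_L0inf_translate lF ci; have l2 := in_L0inf_translate lF cr.
  have l3 := in_L0inf_lin 'i l1 l2.
  have e x : 0 <= x -> 'i * (repr F *c (fun y => Im (chi y))) x +
      (repr F *c (fun y => Re (chi y))) x = translate_integral (repr F) chi x.
    by move=> x0; exact/esym/translate_integral_parts.
  have lchiF : in_L0inf (translate_integral (repr F) chi) by exact: (in_L0inf_ext e l3).
  have -> : cls (translate_integral (repr F) chi) =
      'i *: cls (repr F *c (fun y => Im (chi y))) +
      cls (repr F *c (fun y => Re (chi y))).
    have <- := cls_lin 'i l1 l2.
    by apply: (cls_ext lchiF l3); apply: aeW => x x0; rewrite e.
  have -> := dual_lin n 'i (cls (repr F *c (fun y => Im (chi y))))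
    (cls (repr F *c (fun y => Re (chi y)))).
  apply: esym; apply: etrans
    (congr2 (fun x y : R[i] => 'i * x + y) (gE _ ci) (gE _ cr)) _.
  have /in_L0infP[rr ri] := in_L0inf_repr (cls g).
  have /in_L0infP[gr gi] := lg.
  have er : \forall x \ae mu, 0 <= x -> Re (repr (cls g) x) = Re (g x).
    by apply: filterS (repr_cls lg) => x h x0; rewrite h.
  have ei : \forall x \ae mu, 0 <= x -> Im (repr (cls g) x) = Im (g x).
    by apply: filterS (repr_cls lg) => x h x0; rewrite h.
  rewrite !(ae_eq_Rintegral_pair rr gr _ er)// !(ae_eq_Rintegral_pair ri gi _ ei)//.
  by apply/eqP; rewrite eq_complex /=; apply/andP; split; apply/eqP; ring.
move=> lphi; have lphiC := in_L1_real lphi.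
have H := xgetPex 0 ex; have <- := H _ lphiC.
rewrite -[xget _ _]/(dual_act n F) cintegral_mul//; last exact: in_L0inf_repr.
have z (u : R -> R) : \int[mu]_(x in J) (u x * Im ((phi x)%:C)) = 0.
  transitivity (\int[mu]_(x in J) (cst (0 : R) x)); last first.
    by rewrite Rintegral_cst ?mul0r.
  by apply: eq_Rintegral => x _; rewrite /= mulr0.
by rewrite !z subr0 add0r.
Qed.

Lemma cls_eq_primitive f g : in_L0inf f -> in_L0inf g ->
  (forall a, 0 <= a ->
    \int[mu]_(x in `[0, a]) Re (f x) = \int[mu]_(x in `[0, a]) Re (g x)) ->
  (forall a, 0 <= a ->
    \int[mu]_(x in `[0, a]) Im (f x) = \int[mu]_(x in `[0, a]) Im (g x)) ->
  cls f = cls g.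
Proof.
move=> lf lg er ei; have /in_L0infP[fr fi] := lf; have /in_L0infP[gr gi] := lg.
have part (u v : R -> R) : rL0 u -> rL0 v -> (forall a, 0 <= a ->
    \int[mu]_(x in `[0, a]) u x = \int[mu]_(x in `[0, a]) v x) ->
    \forall x \ae mu, 0 <= x -> u x = v x.
  move=> lu lv e.
  have := @ae_eq0_primitive _ _ (rL0_locint (rL0_lin (-1) lu lv)).
  have [_ iu] := rL0_locint lu; have [_ iv] := rL0_locint lv.
  move=> H; apply: filterS (H _) => [x h x0|a a0].
    by have := h x0; lra.
  by rewrite Rintegral_lin// e//; ring.
apply: cls_ext => //; apply: filterS2 (part _ _ fr gr er) (part _ _ fi gi ei).
move=> x h1 h2 x0; apply/eqP; rewrite eq_complex; apply/andP.
by split; apply/eqP; [exact: h1|exact: h2].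
Qed.

Lemma dual_act_step n F a :
  n (cls (repr F *c step a)) =
  \int[mu]_(x in `[0, a]) Re (repr (dual_act n F) x) +i*
  \int[mu]_(x in `[0, a]) Im (repr (dual_act n F) x).
Proof. by rewrite dual_actP ?Rintegral_step//; exact: rL1_step. Qed.

(* Step functions suffice to identify [n F], since a function in L_0^oo(w) is
   determined a.e. by its primitive. *)
Lemma dual_act_eq n F g : in_L0inf g ->
  (forall a, 0 <= a -> n (cls (repr F *c step a)) =
    \int[mu]_(x in `[0, a]) Re (g x) +i* \int[mu]_(x in `[0, a]) Im (g x)) ->
  dual_act n F = cls g.
Proof.
move=> lg e; rewrite -[LHS]cls_repr; apply: cls_eq_primitive => //.
- exact: in_L0inf_repr.
- by move=> a a0; have := e a a0; rewrite dual_act_step => -[].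
- by move=> a a0; have := e a a0; rewrite dual_act_step => -[].
Qed.

Lemma cls_lin_repr a F G :
  cls (fun x => a * repr F x + repr G x) = a *: F + G.
Proof.
by rewrite (cls_lin a (in_L0inf_repr F) (in_L0inf_repr G)) !cls_repr.
Qed.

Lemma cintegral_lin a f g b : in_L0inf f -> in_L0inf g ->
  a * (\int[mu]_(x in `[0, b]) Re (f x) +i* \int[mu]_(x in `[0, b]) Im (f x)) +
  (\int[mu]_(x in `[0, b]) Re (g x) +i* \int[mu]_(x in `[0, b]) Im (g x)) =
  \int[mu]_(x in `[0, b]) Re (a * f x + g x) +i*
  \int[mu]_(x in `[0, b]) Im (a * f x + g x).
Proof.
move=> lf lg.
have /in_L0infP[fr fi] := lf; have /in_L0infP[gr gi] := lg.
have [_ /(_ b) ifr] := rL0_locint fr; have [_ /(_ b) ifi] := rL0_locint fi.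
have [_ /(_ b) igr] := rL0_locint gr; have [_ /(_ b) igi] := rL0_locint gi.
have -> : \int[mu]_(x in `[0, b]) Re (a * f x + g x) =
    Re a * \int[mu]_(x in `[0, b]) Re (f x) + (- Im a *
    \int[mu]_(x in `[0, b]) Im (f x) + \int[mu]_(x in `[0, b]) Re (g x)).
  rewrite -!Rintegral_lin//; last exact: integrable_lin.
  by apply: eq_Rintegral => x _; case: (a) (f x) (g x) => ? ? [? ?] [? ?] /=; ring.
have -> : \int[mu]_(x in `[0, b]) Im (a * f x + g x) =
    Re a * \int[mu]_(x in `[0, b]) Im (f x) + (Im a *
    \int[mu]_(x in `[0, b]) Re (f x) + \int[mu]_(x in `[0, b]) Im (g x)).
  rewrite -!Rintegral_lin//; last exact: integrable_lin.
  by apply: eq_Rintegral => x _; case: (a) (f x) (g x) => ? ? [? ?] [? ?] /=; ring.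
by apply/eqP; rewrite eq_complex; case: (a) => a1 a2 /=;
  apply/andP; split; apply/eqP; ring.
Qed.

Lemma dual_act_lin n a F G :
  dual_act n (a *: F + G) = a *: dual_act n F + dual_act n G.
Proof.
have lF := in_L0inf_repr F; have lG := in_L0inf_repr G.
have lf := in_L0inf_repr (dual_act n F); have lg := in_L0inf_repr (dual_act n G).
have <- := cls_lin_repr a (dual_act n F) (dual_act n G).
apply: dual_act_eq => [|b b0]; first exact: (in_L0inf_lin a lf lg).
have lb := rL1_step w b.
have l1 := in_L0inf_translate lF lb; have l2 := in_L0inf_translate lG lb.
have -> : cls (repr (a *: F + G) *c step b) =
    a *: cls (repr F *c step b) + cls (repr G *c step b).
  have <- := cls_lin a l1 l2; apply: cls_ext.
  - exact: (in_L0inf_translate (in_L0inf_repr _) lb).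
  - exact: (in_L0inf_lin a l1 l2).
  have e : \forall x \ae mu, 0 <= x ->
      repr (a *: F + G) x = a * repr F x + repr G x.
    apply: filterS (repr_cls (in_L0inf_lin a lF lG)) => x.
    by rewrite (cls_lin_repr a F G).
  apply: aeW => x x0; rewrite !translate_integralE.
  have /in_L0infP[Fr Fi] := lF; have /in_L0infP[Gr Gi] := lG.
  have /in_L0infP[lr li] := in_L0inf_repr (a *: F + G).
  have lr' := rL0_lin (Re a) Fr (rL0_lin (- Im a) Fi Gr).
  have li' := rL0_lin (Re a) Fi (rL0_lin (Im a) Fr Gi).
  rewrite (tr_ext x0 lr lr' lb); last first.
    apply: filterS e => z h z0; rewrite h//.
    by case: (a) (repr F z) (repr G z) => ? ? [? ?] [? ?] /=; ring.
  rewrite (tr_ext x0 li li' lb); last first.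
    apply: filterS e => z h z0; rewrite h//.
    by case: (a) (repr F z) (repr G z) => ? ? [? ?] [? ?] /=; ring.
  rewrite !(tr_linl (w := w))//; try exact: rL0_lin.
  by apply/eqP; rewrite eq_complex; case: (a) => a1 a2 /=;
    apply/andP; split; apply/eqP; ring.
have -> := dual_lin n a (cls (repr F *c step b)) (cls (repr G *c step b)).
apply: etrans (congr2 (fun x y : R[i] => a * x + y)
  (dual_act_step n F b) (dual_act_step n G b)) _.
exact: (cintegral_lin a b lf lg).
Qed.

(** The case [X = 0] of [rbnd_of_pairing] bounds each part of [n F] by [c] times the norm of [F];
    hence [c + c]. *)
Lemma dual_act_bounded n : exists2 c, 0 <= c &
  forall F, L0inf_norm (dual_act n F) <= c * L0inf_norm F.
Proof.
have [c c0 nc] := dual_translate_le n.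
exists (c + c) => [|F]; first exact: addr_ge0.
have [F0 bF] := L0inf_norm_bnd F; have lF := in_L0inf_repr F.
have le phi : rL1 phi ->
    normc (n (cls (repr F *c phi))) <= c * L0inf_norm F * nrm1 phi.
  move=> lphi; apply: (nc _ _ 0) => // y /andP[y0]; by rewrite ltNge y0.
apply: L0inf_norm_le; rewrite mulrDl.
have /in_L0infP[lr li] := in_L0inf_repr (dual_act n F).
have [mr [M M0 bM] _] := lr; have [mi [N N0 bN] _] := li.
apply: parts_cbnd.
- apply: (rbnd_of_pairing mr M0 bM _ (lexx 0) (mulr_ge0 c0 F0)
    (la := fun phi => Re (n (cls (repr F *c phi))))) => phi lphi.
    by rewrite dual_actP.
  by move=> _; apply: le_trans (normc_geRe _) (le _ lphi).
- apply: (rbnd_of_pairing mi N0 bN _ (lexx 0) (mulr_ge0 c0 F0)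
    (la := fun phi => Im (n (cls (repr F *c phi))))) => phi lphi.
    by rewrite dual_actP.
  by move=> _; apply: le_trans (normc_geIm _) (le _ lphi).
Qed.

(** The composite is linear and bounded, hence in the dual, so [insubd] does not fall back on its
    default. *)
Lemma arensE (m n : dual w) F : arens m n F = m (dual_act n F).
Proof.
rewrite /arens; set u := fun F => m (dual_act n F).
suff up : u \in @dual_pred R w by rewrite -[LHS]/(\val (insubd 0 u) F) insubdK.
have [c c0 nc] := dual_act_bounded n.
have [d d0 md] := dual_bounded m.
apply/asboolP; split => [a G H|].
  by rewrite /u dual_act_lin dual_lin.
exists (d * c) => G; rewrite /u -mulrA.
apply: le_trans (_ : d * L0inf_norm (dual_act n G) <= _).
  rewrite -{1}(cls_repr (dual_act n G)); apply: md; first exact: in_L0inf_repr.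
  by have [] := L0inf_norm_bnd (dual_act n G).
by rewrite ler_wpM2l.
Qed.

End dual_action.

(** * The characters [n |-> <n, exp(-s x)>] *)

Section characters.
Context {R : realType} (w : weight R).
Notation mu := (@lebesgue_measure R).
Notation rL0 := (rL0 w).
Notation Re := complex.Re.
Notation Im := complex.Im.
Notation in_L0inf := (in_L0inf w).
Notation cls := (L0inf_class w).
Notation "f *c phi" := (translate_integral f (fun y => (phi y)%:C)) (at level 40).
Implicit Types (f g : R -> R[i]) (F G : L0inf w) (X M : R) (phi u v : R -> R)
  (m n : dual w).

(* Otherwise unification compares two classes by unfolding the quotient. *)
#[local] Opaque L0inf_class translate_integral dual_act arens.

Lemma rL0_0 : rL0 (fun=> 0).
Proof.
split; first exact: measurable_cst.
  by exists 0 => //; apply: aeW => x _; rewrite normr0 mul0r.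
move=> e e0; exists 0 => //; apply: aeW => x x0.
by rewrite normr0 mulr_ge0// ltW// weight_gt0.
Qed.

Lemma in_L0inf_real u : rL0 u -> in_L0inf (fun x => (u x)%:C).
Proof. by move=> lu; apply/in_L0infP; split => //; exact: rL0_0. Qed.

Lemma cls_scale a f : in_L0inf f -> cls (fun x => a * f x) = a *: cls f.
Proof.
move=> lf; have l0 := in_L0inf_real rL0_0.
have e0 : cls (fun=> 0%:C) = 0.
  have := cls_lin (-1) l0 l0; rewrite scaleN1r addNr => <-; congr (cls _).
  by apply/funext => x; rewrite mulN1r addNr.
rewrite -[RHS]addr0 -e0 -cls_lin//; congr (cls _); apply/funext => x.
by rewrite addr0.
Qed.

Lemma dual0 n : n 0 = 0.
Proof.
have := dual_lin n 1 0 0; rewrite scaler0 addr0 mul1r => /eqP.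
by rewrite eq_sym -subr_eq0 addrK => /eqP.
Qed.

Lemma dual_scale n a F : n (a *: F) = a * n F.
Proof. by rewrite -[a *: F]addr0 dual_lin dual0 addr0. Qed.

Lemma dual_ext m n : (forall F, m F = n F) -> m = n.
Proof. by move=> e; apply: val_inj; apply/funext. Qed.

(** The representative of [cls f] agrees with [f] only almost everywhere, but the translation
    product depends on the class alone. This allows computation with explicit functions. *)
Lemma dual_act_class n f g : in_L0inf f -> in_L0inf g ->
  (forall a, 0 <= a -> n (cls (f *c step a)) =
    \int[mu]_(x in `[0, a]) Re (g x) +i* \int[mu]_(x in `[0, a]) Im (g x)) ->
  dual_act n (cls f) = cls g.
Proof.
move=> lf lg e; apply: (dual_act_eq lg) => a a0.
have la := rL1_step w a; have lr := in_L0inf_repr (cls f).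
apply: etrans _ (e a a0); apply: (congr1 (fun F : L0inf w => n F : R[i])).
apply: cls_ext; [exact: in_L0inf_translate|exact: in_L0inf_translate|].
apply: aeW => x x0; rewrite !translate_integralE.
have /in_L0infP[fr fi] := lf; have /in_L0infP[rr ri] := lr.
congr (_ +i* _); apply: tr_ext x0 _ _ la _ => //.
  by apply: filterS (repr_cls lf) => z h z0; rewrite h.
by apply: filterS (repr_cls lf) => z h z0; rewrite h.
Qed.

Definition expN (s x : R) : R := expR (- (s * x)).

Lemma expN_le1 s x : 0 <= s -> 0 <= x -> expN s x <= 1.
Proof. by move=> s0 x0; rewrite /expN -expR0 ler_expR oppr_le0 mulr_ge0. Qed.

Lemma continuous_expN s : continuous (expN s).
Proof.
move=> x; apply: continuous_comp; last exact: continuous_expR.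
by apply: cvgN; apply: cvgM; [exact: cvg_cst|exact: cvg_id].
Qed.

Lemma expN_le_inv d x : 0 < d -> 0 < x -> expN d x <= (d * x)^-1.
Proof.
move=> d0 x0; rewrite /expN expRN lef_pV2 ?posrE ?expR_gt0 ?mulr_gt0//.
by apply: le_trans (expR_ge1Dx _); rewrite lerDr.
Qed.

Lemma rL0_expN s : 0 < s -> rL0 (expN s).
Proof.
move=> s0; have nexp x : `|expN s x| = expN s x by rewrite ger0_norm// expR_ge0.
split.
- apply: measurable_funTS; apply: continuous_measurable_fun.
  exact: continuous_expN.
- exists 1 => //; apply: aeW => x x0; rewrite nexp mul1r.
  by apply: le_trans (weight_ge1 w x0); exact: expN_le1 (ltW s0) x0.
(* Beyond this point [expN s x <= (s * x)^-1 <= e]. *)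
move=> e e0; exists (s * e)^-1; first by rewrite invr_ge0 mulr_ge0// ltW.
have se0 : 0 < (s * e)^-1 by rewrite invr_gt0 mulr_gt0.
apply: aeW => x Xx; have x0 := lt_le_trans se0 Xx; rewrite nexp.
apply: le_trans (expN_le_inv s0 x0) _.
apply: (@le_trans _ _ e); last first.
  by rewrite ler_peMr ?(ltW e0)// weight_ge1// ltW.
by rewrite invf_ple ?posrE ?mulr_gt0// -ler_pdivrMl// -invfM.
Qed.

Definition chi s n : R[i] := n (cls (fun x => (expN s x)%:C)).

(** Translation multiplies an exponential by a scalar, so its product with [step a] is [I] times
    itself, [I] being its integral over [[0, a]]. Applying [n] gives [I * chi s n], the primitive of
    the right-hand side. *)
Lemma dual_act_expN s n : 0 < s ->
  dual_act n (cls (fun x => (expN s x)%:C)) = chi s n *: cls (fun x => (expN s x)%:C).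
Proof.
move=> s0; have ls := rL0_expN s0; have lc := in_L0inf_real ls.
rewrite -cls_scale//; apply: dual_act_class => // [|a a0].
  have := in_L0inf_lin (chi s n) lc (in_L0inf_real rL0_0).
  by under eq_fun do rewrite addr0.
have [_ /(_ a) ia] := rL0_locint ls.
pose I := \int[mu]_(x in `[0, a]) expN s x.
have -> : cls ((fun x => (expN s x)%:C) *c step a) =
    I%:C *: cls (fun x => (expN s x)%:C).
  have <- := cls_scale I%:C lc; apply: cls_ext.
  - exact: (in_L0inf_translate lc (rL1_step w a)).
  - have := in_L0inf_lin I%:C lc (in_L0inf_real rL0_0).
    by under eq_fun do rewrite addr0.
  apply: aeW => x x0; rewrite translate_integralE/= !tr_step.
  have -> : \int[mu]_(y in `[0, a]) expN s (x + y) = I * expN s x.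
    rewrite mulrC -RintegralZl//; apply: eq_Rintegral => y _.
    by rewrite /expN mulrDr opprD expRD.
  rewrite (_ : \int[mu]_(y in `[0, a]) 0 = 0); last first.
    by rewrite Rintegral_cst ?mul0r.
  by apply/eqP; rewrite eq_complex /=; apply/andP; split; apply/eqP; ring.
have -> := dual_scale n I%:C (cls (fun x => (expN s x)%:C)).
rewrite -/(chi s n); case: (chi s n) => p q /=.
have -> : \int[mu]_(x in `[0, a]) (p * expN s x - q * 0) = p * I.
  by rewrite -RintegralZl//; apply: eq_Rintegral => x _; ring.
have -> : \int[mu]_(x in `[0, a]) (p * 0 + q * expN s x) = q * I.
  by rewrite -RintegralZl//; apply: eq_Rintegral => x _; ring.
by apply/eqP; rewrite eq_complex /=; apply/andP; split; apply/eqP; ring.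
Qed.

Lemma chi_arens s m n : 0 < s -> chi s (arens m n) = chi s m * chi s n.
Proof.
move=> s0; rewrite [LHS]/chi arensE dual_act_expN// dual_scale.
exact: mulrC.
Qed.

(** Piecewise linear, 1 up to [X] and 0 from [X + 1] on; absolute values make its continuity
    immediate. *)
Definition cutoff (X x : R) : R := (1 + `|X + 1 - x| - `|X - x|) / 2.

Lemma cutoff01 X x : 0 <= cutoff X x <= 1.
Proof.
rewrite /cutoff divr_ge0 ?ler_pdivrMr//=.
  by case: (ger0P (X + 1 - x)) => ?; case: (ger0P (X - x)) => ?; lra.
by case: (ger0P (X + 1 - x)) => ?; case: (ger0P (X - x)) => ?; lra.
Qed.

Lemma cutoff1 X x : x <= X -> cutoff X x = 1.
Proof. by move=> xX; rewrite /cutoff !ger0_norm; lra. Qed.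

Lemma cutoff0 X x : X + 1 <= x -> cutoff X x = 0.
Proof. by move=> xX; rewrite /cutoff !ler0_norm; lra. Qed.

Lemma continuous_cutoff X : continuous (cutoff X).
Proof.
move=> x; apply: cvgM; last exact: cvg_cst.
by apply: cvgB; [apply: cvgD; first exact: cvg_cst|]; apply: cvg_norm;
  (apply: cvgB; [exact: cvg_cst|exact: cvg_id]).
Qed.

(* [g] truncated to a compact set and transported to [[0, 1]] by [t = exp(-x)]. *)
Definition log_cutoff X (g : R -> R) (t : R) : R :=
  if 0 < t then cutoff X (- ln t) * g (- ln t) else 0.

Lemma log_cutoff0 X (g : R -> R) : log_cutoff X g 0 = 0.
Proof. by rewrite /log_cutoff ltxx. Qed.

(** At [t <= 0] the function is locally 0: for [t] below [exp(- (X + 1))] the point [- ln t] lies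
    where the cutoff vanishes. *)
Lemma continuous_log_cutoff X (g : R -> R) : continuous g ->
  continuous (log_cutoff X g).
Proof.
move=> gc t; have [t0|t0] := ltP 0 t.
  have h : {for t, continuous (fun t => cutoff X (- ln t) * g (- ln t))}.
    have lnc : (fun t : R => - ln t) x @[x --> t] --> - ln t.
      by apply: cvgN; exact: continuous_ln.
    apply: cvgM.
      by apply: (@continuous_comp _ _ _ (fun t => - ln t) (cutoff X)) => //;
        exact: continuous_cutoff.
    by apply: (@continuous_comp _ _ _ (fun t => - ln t) g) => //; exact: gc.
  have tE : log_cutoff X g t = cutoff X (- ln t) * g (- ln t).
    by rewrite /log_cutoff t0.
  rewrite /continuous_at tE; apply: cvg_trans h; apply: near_eq_cvg.
  by near=> z; rewrite /log_cutoff ifT//; near: z; exact: lt_nbhsr.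
have tE : log_cutoff X g t = 0 by rewrite /log_cutoff ltNge t0.
rewrite /continuous_at tE; apply: (@cvg_near_cst R^o).
near=> z; rewrite /log_cutoff; case: ifPn => // z0.
rewrite cutoff0 ?mul0r// -[X in X <= _]opprK lerN2 -ler_expR lnK ?posrE//.
apply: ltW; near: z; apply: lt_nbhsl; apply: le_lt_trans t0 _; exact: expR_gt0.
Unshelve. all: by end_near. Qed.

(** One [e] is the truncation error, supported beyond [X]; the other is the polynomial error, a
    uniform bound that [w >= 1] turns into a weighted one. *)
Lemma log_cutoff_approx e X (g : R -> R) (p : {poly R}) : 0 < e ->
  rbnd w X e g ->
  (forall t, 0 <= t <= 1 -> `|log_cutoff X g t - p.[t]| <= e) ->
  rbnd w 0 (e + e) (fun x => -1 * p.[expR (- x)] + g x).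
Proof.
move=> e0 bX hp; apply: filterS bX => x gx x0.
have ex : 0 <= expR (- x) <= 1.
  by rewrite expR_ge0/= -expR0 ler_expR oppr_le0.
have w1 := weight_ge1 w x0.
have ew : e <= e * w x by rewrite ler_peMr// ltW.
have := hp _ ex.
rewrite /log_cutoff expR_gt0 expRK opprK => hx.
have gcx : `|g x - cutoff X x * g x| <= e * w x.
  have [xX|Xx] := leP x X.
    rewrite cutoff1// mul1r subrr normr0; exact: le_trans (ltW e0) ew.
  rewrite -[X in `|X - _|]mul1r -mulrBl normrM.
  apply: le_trans (gx (ltW Xx)); rewrite ler_piMl//.
  by have := cutoff01 X x => /andP[h1 h2]; rewrite ler_norml; lra.
have -> : -1 * p.[expR (- x)] + g x =
    (g x - cutoff X x * g x) + (cutoff X x * g x - p.[expR (- x)]) by ring.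
apply: le_trans (ler_normD _ _) _; rewrite mulrDl lerD//.
exact: le_trans hx ew.
Qed.

(** Membership is carried along because [cls] returns a default outside L_0^oo(w), and is linear
    only inside. *)
Definition vanishing n u := rL0 u /\ n (cls (fun x => (u x)%:C)) = 0.

Lemma dual_real_lin n a u v : rL0 u -> rL0 v ->
  n (cls (fun x => (a * u x + v x)%:C)) =
  a%:C * n (cls (fun x => (u x)%:C)) + n (cls (fun x => (v x)%:C)).
Proof.
move=> lu lv; rewrite -dual_lin -cls_lin; try exact: in_L0inf_real.
congr (n (cls _)); apply/funext => x.
by apply/eqP; rewrite eq_complex /=; apply/andP; split; apply/eqP; ring.
Qed.

Lemma vanishing_lin n a u v : vanishing n u -> vanishing n v ->
  vanishing n (fun x => a * u x + v x).
Proof.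
move=> [lu nu] [lv nv]; split; first exact: rL0_lin.
apply: etrans (dual_real_lin n a lu lv) _.
apply: etrans (congr2 (fun x y : R[i] => a%:C * x + y) nu nv) _.
by rewrite mulr0 addr0.
Qed.

(** The factor [expR (- x) ^+ k.+1] makes every monomial a decaying exponential; [k] varies because
    the induction on [q] moves a factor ['X] into it. *)
Lemma vanishing_poly n (q : {poly R}) k :
  (forall s, 0 < s -> chi s n = 0) ->
  vanishing n (fun x => q.[expR (- x)] * expR (- x) ^+ k.+1).
Proof.
move=> n0; have base j : vanishing n (fun x => expR (- x) ^+ j.+1).
  have -> : (fun x => expR (- x) ^+ j.+1) = expN j.+1%:R.
    by apply/funext => x; rewrite -expRM_natl /expN mulrN.
  by split; [exact: rL0_expN|exact: n0].
elim/poly_ind: q k => [|q c IH] k.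
  have := vanishing_lin (-1) (base 0%N) (base 0%N).
  congr vanishing; apply/funext => x.
  by rewrite horner0 mul0r mulN1r addNr.
have := vanishing_lin c (base k) (IH k.+1).
congr vanishing; apply/funext => x; rewrite hornerMXaddC !exprS.
by ring.
Qed.

Lemma dual_vanish n (g : R -> R) : (forall s, 0 < s -> chi s n = 0) ->
  continuous g -> rL0 g -> n (cls (fun x => (g x)%:C)) = 0.
Proof.
move=> n0 gc lg; have [c c0 nc] := dual_bounded n.
suff le e : 0 < e -> normc (n (cls (fun x => (g x)%:C))) <= c * (e + e).
  apply: eq0_normc; apply/eqP; rewrite eq_le normc_ge0 andbT.
  apply/ler_addgt0Pl => d d0; rewrite addr0.
  have c1 : 0 < c + 1 by rewrite ltr_wpDl.
  (* Chosen so that [c * (e + e) <= d]; [c + 1] avoids a division by 0. *)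
  have e0 : 0 < d / (2 * (c + 1)) by rewrite divr_gt0// mulr_gt0.
  apply: le_trans (le _ e0) _.
  have -> : d / (2 * (c + 1)) + d / (2 * (c + 1)) = d / (c + 1).
    by field; rewrite gt_eqF.
  by rewrite mulrCA ler_piMr ?(ltW d0)// ler_pdivrMr// mul1r lerDl.
move=> e0; have [_ _ /(_ _ e0)[X X0 bX]] := lg.
have [p p0 hp] := weierstrass_approx (@continuous_log_cutoff X g gc)
  (log_cutoff0 X g) e0.
have /factor_theorem[q pq] : root p 0 by apply/eqP.
have vu : vanishing n (fun x => p.[expR (- x)]).
  have := vanishing_poly q 0 n0; congr vanishing; apply/funext => x.
  by rewrite pq subr0 hornerM hornerX expr1.
have [lu nu] := vu.
have <- : n (cls (fun x => (-1 * p.[expR (- x)] + g x)%:C)) =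
    n (cls (fun x => (g x)%:C)).
  apply: etrans (dual_real_lin n (-1) lu lg) _.
  apply: etrans (congr2 (fun x y : R[i] => (-1)%:C * x + y) nu (erefl _)) _.
  by rewrite mulr0 add0r.
apply: nc; first exact: (in_L0inf_real (rL0_lin (-1) lu lg)).
apply: filterS (log_cutoff_approx e0 bX hp) => x gx x0 /=.
by rewrite expr0n addr0 sqrtr_sqr; exact: gx.
Qed.

Lemma dual_act_vanish n F : (forall s, 0 < s -> chi s n = 0) -> dual_act n F = 0.
Proof.
move=> n0; have lF := in_L0inf_repr F; have /in_L0infP[lr li] := lF.
have l0 := in_L0inf_real rL0_0.
have c0 : cls (fun=> 0%:C) = 0.
  have := cls_scale 0 l0; rewrite scale0r => <-; congr (cls _).
  by apply/funext => x; rewrite mul0r.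
rewrite -c0; apply: (dual_act_eq l0) => a a0.
have la := rL1_step w a.
have nG u : rL0 u -> n (cls (fun x => (window a u x)%:C)) = 0.
  move=> lu.
  exact: (dual_vanish n0 (continuous_window (a := a) lu) (rL0_window a0 lu)).
have -> : cls (repr F *c step a) =
    'i *: cls (fun x => (window a (fun x => Im (repr F x)) x)%:C) +
    cls (fun x => (window a (fun x => Re (repr F x)) x)%:C).
  rewrite -cls_lin; [|exact/in_L0inf_real/rL0_window|exact/in_L0inf_real/rL0_window].
  apply: cls_ext; first exact: in_L0inf_translate.
    by apply: in_L0inf_lin; exact/in_L0inf_real/rL0_window.
  apply: aeW => x x0; rewrite translate_integralE !(tr_window (w := w))//.
  by apply/eqP; rewrite eq_complex /=; apply/andP; split; apply/eqP; ring.
have -> := dual_lin n 'i (cls (fun x => (window a (fun x => Im (repr F x)) x)%:C))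
  (cls (fun x => (window a (fun x => Re (repr F x)) x)%:C)).
apply: etrans (congr2 (fun x y : R[i] => 'i * x + y) (nG _ li) (nG _ lr)) _.
by rewrite mulr0 addr0 !Rintegral_cst// !mul0r.
Qed.

Lemma ran_chi n : (forall s, 0 < s -> chi s n = 0) -> ran w n.
Proof.
move=> n0 a; apply: dual_ext => F.
by rewrite arensE dual_act_vanish// dual0.
Qed.

(** For [s <= t] the two exponentials differ by at most [(t - s) * x * exp(- s x)], and
    [x * exp(- s x) <= 1 / s <= 1 / d]. *)
Lemma chi_continuous n : exists2 c, 0 <= c &
  forall d s t, 0 < d -> d <= s -> d <= t ->
    normc (chi s n - chi t n) <= c * (`|s - t| / d).
Proof.
have [c c0 nc] := dual_bounded n; exists c => // d s t d0.
wlog st : s t / s <= t => [H ds dt|ds dt].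
  have /orP[st|ts] := le_total s t; first exact: H.
  rewrite -normcN opprB distrC; exact: H.
have s0 := lt_le_trans d0 ds; have t0 := lt_le_trans d0 dt.
have ls := rL0_expN s0; have lt := rL0_expN t0.
have -> : chi s n - chi t n = n (cls (fun x => (-1 * expN t x + expN s x)%:C)).
  apply: etrans _ (esym (dual_real_lin n (-1) lt ls)).
  change (chi s n - chi t n = (-1)%:C * chi t n + chi s n).
  by rewrite rmorphN1 mulN1r addrC.
apply: nc; first exact/in_L0inf_real/rL0_lin.
apply: aeW => x x0 /=; rewrite expr0n addr0 sqrtr_sqr.
have w1 := weight_ge1 w x0.
suff h : `|-1 * expN t x + expN s x| <= `|s - t| / d.
  by apply: le_trans h _; rewrite ler_peMr// divr_ge0// ltW.
have tE : expN t x = expN s x * expR (- ((t - s) * x)).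
  by rewrite /expN -expRD; congr expR; ring.
have e1 : 1 - (t - s) * x <= expR (- ((t - s) * x)) by exact: expR_ge1Dx.
have e2 : expR (- ((t - s) * x)) <= 1.
  by apply: (@expN_le1 (t - s)) => //; rewrite subr_ge0.
have es : 0 < expN s x by exact: expR_gt0.
have -> : -1 * expN t x + expN s x =
    expN s x * (1 - expR (- ((t - s) * x))) by rewrite tE; ring.
rewrite ger0_norm; last by rewrite mulr_ge0 ?(ltW es)// subr_ge0.
apply: (@le_trans _ _ (expN s x * ((t - s) * x))).
  by rewrite ler_pM2l//; lra.
rewrite distrC ger0_norm ?subr_ge0// mulrCA ler_wpM2l ?subr_ge0//.
move: x0; rewrite le_eqVlt => /predU1P[<-|x0].
  by rewrite mulr0 invr_ge0 ltW.
rewrite -ler_pdivlMr//; apply: le_trans (expN_le_inv s0 x0) _.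
rewrite -invfM lef_pV2 ?posrE ?mulr_gt0//.
by rewrite ler_pM2r.
Qed.

(* [chi s n] is 0 or 1 and is Lipschitz in [s] on each [[d, +oo[]. *)
Lemma chi_idempotent n s t : arens n n = n -> 0 < s -> 0 < t -> chi s n = chi t n.
Proof.
move=> nn s0 t0; have [c c0 nc] := chi_continuous n.
have idem r : 0 < r -> chi r n = 0 \/ chi r n = 1.
  move=> r0; have := chi_arens n n r0; rewrite nn => e.
  have : chi r n * (chi r n - 1) = 0 by rewrite mulrBr mulr1 -e subrr.
  by move/eqP; rewrite mulf_eq0 subr_eq0 => /orP[/eqP|/eqP]; [left|right].
pose d := Num.min s t; have d0 : 0 < d by rewrite lt_min s0.
(* Parameters at distance at most [e] give values at distance less than 1, hence equal values among
   0 and 1. *)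
pose e := d / (c + 1) / 2.
have c1 : 0 < c + 1 by rewrite ltr_wpDl.
have e0 : 0 < e by rewrite !divr_gt0.
have small a b : d <= a -> d <= b -> `|a - b| <= e -> chi a n = chi b n.
  move=> da db ab.
  have lt1 : normc (chi a n - chi b n) < 1.
    apply: le_lt_trans (nc _ _ _ d0 da db) _.
    apply: (@le_lt_trans _ _ (c * (e / d))).
      by rewrite ler_wpM2l// ler_wpM2r// invr_ge0 ltW.
    have -> : c * (e / d) = c / (c + 1) / 2.
      by rewrite /e; field; rewrite !gt_eqF.
    rewrite ltr_pdivrMr// ltr_pdivrMr//; lra.
  have n1 : normc (1 : R[i]) = 1 by rewrite /= expr0n addr0 expr1n sqrtr1.
  move: lt1; case: (idem a (lt_le_trans d0 da)) => ->;
    case: (idem b (lt_le_trans d0 db)) => -> //.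
    by rewrite sub0r normcN n1 ltxx.
  by rewrite subr0 n1 ltxx.
(* Longer distances are covered by at most [k] steps of length at most [e]. *)
have chain k a b : d <= a -> a <= b -> b <= a + e *+ k -> chi a n = chi b n.
  elim: k b => [|k IH] b da ab.
    rewrite mulr0n addr0 => ba; congr (chi _ n); apply/eqP.
    by rewrite eq_le ab.
  rewrite mulrS => bk; have [bae|aeb] := leP b (a + e).
    apply: small => //; first exact: le_trans ab.
    by rewrite distrC ger0_norm ?subr_ge0//; lra.
  have ab' : a <= b - e by lra.
  transitivity (chi (b - e) n); first by apply: IH => //; lra.
  apply: small; [exact: le_trans ab'|lra|].
  have -> : b - e - b = - e by ring.
  by rewrite normrN ger0_norm// ltW.
have any a b : d <= a -> a <= b -> chi a n = chi b n.
  move=> da ab; apply: (chain (Num.trunc ((b - a) / e)).+1) => //.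
  rewrite -lerBlDl -mulr_natl -ler_pdivrMr//.
  exact/ltW/truncnS_gt.
have [st|ts] := leP s t.
  by apply: any => //; rewrite /d ge_min lexx.
by apply/esym/any; [rewrite /d ge_min lexx orbT|exact: ltW].
Qed.

End characters.

(** * A right identity *)

Section ultralimit.
Variable R : realType.

(** [L] is the limit along an ultrafilter refining the filter of cofinite sets. Bounded sequences
    converge along it because [[- B, B]] is compact, and linearity is claimed for these only. *)
Lemma ultralimit : exists L : (nat -> R) -> R,
  [/\ forall u l, u @ \oo --> l -> L u = l,
      forall (a : R) u v B C, (forall k, `|u k| <= B) -> (forall k, `|v k| <= C) ->
        L (fun k => a * u k + v k) = a * L u + L v &
      forall u B, (forall k, `|u k| <= B) -> `|L u| <= B].
Proof.
have [U [UU sU]] := ultraFilterLemma (@eventually_filter).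
have PU : ProperFilter U by exact: ultra_proper.
have cvU (u : nat -> R) (B : R) : (forall k, `|u k| <= B) ->
    exists2 l, `|l| <= B & u @ U --> l.
  move=> uB.
  (* The image of an ultrafilter is again one, since [U] contains the preimage of [A] or of its
     complement. *)
  have uU : UltraFilter (u @ U).
    split; first exact: fmap_proper_filter.
    move=> G PG sG; apply/seteqP; split => A; last exact: sG.
    move=> GA; have [//|nA] := in_ultra_setVsetC (u @^-1` A) UU.
    have GnA : G (~` A) by exact: sG.
    have G0 : G set0 by rewrite -(setICr A); exact: filterI.
    by case: (@filter_not_empty _ G PG G0).
  have := @segment_compact R (- B) B; rewrite compact_ultra.
  move=> /(_ _ uU) [|l [lB ul]].
    have UB : U [set k | `[- B, B]%classic (u k)].
      by apply: filterE => k /=; rewrite in_itv/= -ler_norml.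
    exact: UB.
  by exists l => //; move: lB; rewrite /= in_itv/= -ler_norml.
exists (fun u => lim (u @ U)); split.
- by move=> u l ul; apply/cvg_lim => //; apply: cvg_trans ul => A /sU.
- move=> a u v B C /cvU[l _ ul] /cvU[m _ vm].
  rewrite (cvg_lim _ ul)// (cvg_lim _ vm)//; apply/cvg_lim => //.
  by apply: cvgD => //; apply: cvgM => //; exact: cvg_cst.
- by move=> u B /cvU[l lB ul]; rewrite (cvg_lim _ ul).
Qed.

End ultralimit.

(** * Averages near 0 and their ultrafilter limit *)

Section right_identity.
Context {R : realType} (w : weight R).
Notation mu := (@lebesgue_measure R).
Notation J := (`[0%R, +oo[%classic : set R).
Notation rL0 := (rL0 w).
Notation rbnd := (rbnd w).
Notation tr := (@tr R).
Notation Re := complex.Re.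
Notation Im := complex.Im.
Notation cls := (L0inf_class w).
Notation "f *c phi" := (translate_integral f (fun y => (phi y)%:C)) (at level 40).
Implicit Types (f : R -> R[i]) (F G : L0inf w) (X M : R) (phi u v : R -> R)
  (m n : dual w).

#[local] Opaque L0inf_class translate_integral dual_act arens.

Definition avg u (k : nat) : R := k.+1%:R * \int[mu]_(x in `[0, k.+1%:R^-1]) u x.

Lemma integrable_cst_itv (c a b : R) :
  mu.-integrable (`[a, b]%classic : set R) (EFin \o cst c).
Proof.
apply/integrableP; split; first by apply/measurable_EFinP; exact: measurable_cst.
rewrite (eq_integral (cst `|c|%:E))// integral_cst//= lte_mul_pinfty//.
by rewrite lebesgue_measure_itv/=; case: ifP => //; rewrite -EFinB ltry.
Qed.

Lemma Rintegral_cst_itv (c h : R) : 0 < h ->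
  \int[mu]_(x in `[0, h]) cst c x = c * h.
Proof.
move=> h0; transitivity (c * fine (mu `[0, h])); first exact: Rintegral_cst.
by rewrite lebesgue_measure_itv/= lte_fin h0 /= subr0.
Qed.

Lemma normr_avg_le u k M : measurable_fun (`[0, k.+1%:R^-1]%classic : set R) u ->
  0 <= M -> (\forall x \ae mu, 0 <= x <= k.+1%:R^-1 -> `|u x| <= M) ->
  `|avg u k| <= M.
Proof.
move=> mu' M0 le; rewrite normrM ger0_norm// mulrC -ler_pdivlMr//.
apply: le_trans (normr_Rintegral_ae_le (g := cst M) _ mu' _ _ _) _ => //.
  exact: integrable_cst_itv.
by rewrite Rintegral_cst_itv ?invr_gt0.
Qed.

Lemma avg_lin a u v k : locint u -> locint v ->
  avg (fun x => a * u x + v x) k = a * avg u k + avg v k.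
Proof. by move=> [_ iu] [_ iv]; rewrite /avg Rintegral_lin//; ring. Qed.

Lemma avg_ext u v k : measurable_fun J u -> measurable_fun J v ->
  (\forall x \ae mu, 0 <= x -> u x = v x) -> avg u k = avg v k.
Proof.
move=> mu' mv uv; congr (_ * _).
have sub : `[0, k.+1%:R^-1]%classic `<=` J.
  by move=> x /=; rewrite !in_itv/= andbT => /andP[].
apply: ae_eq_Rintegral => //; [exact: measurable_funS mu'|exact: measurable_funS mv|].
by apply: filterS uv => x h /sub/J_ge0.
Qed.

(** All the intervals lie in [[0, 1]], where [w] is bounded by [W]; uniformity in [k] is what
    [ultralimit] requires. *)
Lemma avg_bounded : exists2 W, 0 <= W & forall u M k, measurable_fun J u ->
  0 <= M -> rbnd 0 M u -> `|avg u k| <= M * W.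
Proof.
have [W W0 wW] := weight_bounded w 1; exists W => // u M k mu' M0 bM.
apply: normr_avg_le; [|exact: mulr_ge0|].
  by apply: measurable_funS mu' => // x /=; rewrite !in_itv/= andbT => /andP[].
apply: filterS bM => x h /andP[x0 xk]; apply: le_trans (h x0) _.
rewrite ler_wpM2l// wW// x0/=; apply: le_trans xk _.
by rewrite invf_le1// ler1n.
Qed.

Lemma avg_cvg u : locint u -> continuous u -> avg u @ \oo --> u 0.
Proof.
move=> lu cu; apply/cvgrPdist_le => e e0.
have := cu 0 => /cvgrPdist_le/(_ e e0)/nbhs_ballP[d /= d0 dP].
have : (fun k : nat => k.+1%:R^-1 : R) @ \oo --> 0 by exact: cvg_harmonic.
move=> /cvgrPdist_lt/(_ d d0); apply: filterS => k.
rewrite sub0r normrN ger0_norm// => kd.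
have lc : locint (cst (u 0)).
  by split; [exact: measurable_cst|move=> N; exact: integrable_cst_itv].
have -> : u 0 - avg u k = avg (fun x => -1 * u x + cst (u 0) x) k.
  rewrite avg_lin//; suff -> : avg (cst (u 0)) k = u 0 by ring.
  rewrite /avg Rintegral_cst_itv ?invr_gt0//.
  by rewrite mulrCA divff ?mulr1// gt_eqF.
apply: normr_avg_le; [|exact: ltW|].
  apply: measurable_funTS; apply: continuous_measurable_fun => x.
  by apply: cvgD; [apply: cvgM; [exact: cvg_cst|exact: cu]|exact: cvg_cst].
apply: aeW => x /andP[x0 xk].
rewrite mulN1r addrC; apply: dP; rewrite /ball/= sub0r normrN ger0_norm//.
exact: le_lt_trans kd.
Qed.

Lemma right_identity : exists E : dual w, forall m, arens m E = m.
Proof.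
have [L [Llim Llin Lbnd]] := ultralimit R.
have [W W0 avgW] := avg_bounded.
pose E F : R[i]^o := L (avg (fun x => Re (repr F x))) +i*
  L (avg (fun x => Im (repr F x))).
have bnd u : rL0 u -> exists B, forall k, `|avg u k| <= B.
  by move=> [mu' [M M0 bM] _]; exists (M * W) => k; exact: avgW.
have Llin' a u v : rL0 u -> rL0 v ->
    L (avg (fun x => a * u x + v x)) = a * L (avg u) + L (avg v).
  move=> lu lv; have [B uB] := bnd _ lu; have [C vC] := bnd _ lv.
  rewrite -(Llin a _ _ B C)//; congr L; apply/funext => k.
  by apply: avg_lin; [exact: rL0_locint lu|exact: rL0_locint lv].
have Lext u v : rL0 u -> rL0 v -> (\forall x \ae mu, 0 <= x -> u x = v x) ->
    L (avg u) = L (avg v).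
  move=> [mu' _ _] [mv _ _] uv; congr L; apply/funext => k; exact: avg_ext.
have Ein : E \in @dual_pred R w.
  apply/asboolP; split.
    move=> a F G.
    have lFG := in_L0inf_lin a (in_L0inf_repr F) (in_L0inf_repr G).
    have := repr_cls lFG; rewrite (cls_lin_repr a F G) => e.
    have /in_L0infP[hr hi] := in_L0inf_repr (a *: F + G).
    have /in_L0infP[Fr Fi] := in_L0inf_repr F.
    have /in_L0infP[Gr Gi] := in_L0inf_repr G.
    have kr := rL0_lin (- Im a) Fi Gr; have hr' := rL0_lin (Re a) Fr kr.
    have ki := rL0_lin (Im a) Fr Gi; have hi' := rL0_lin (Re a) Fi ki.
    rewrite /E (Lext _ _ hr hr'); last first.
      apply: filterS e => x h x0; rewrite h//.
      by case: (a) (repr F x) (repr G x) => ? ? [? ?] [? ?] /=; ring.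
    rewrite (Lext _ _ hi hi'); last first.
      apply: filterS e => x h x0; rewrite h//.
      by case: (a) (repr F x) (repr G x) => ? ? [? ?] [? ?] /=; ring.
    rewrite (Llin' _ _ _ Fr kr) (Llin' _ _ _ Fi Gr).
    rewrite (Llin' _ _ _ Fi ki) (Llin' _ _ _ Fr Gi).
    apply/eqP; rewrite eq_complex; case: (a) => a1 a2 /=.
    by apply/andP; split; apply/eqP; ring.
  exists (W + W) => F; have [F0 bF] := L0inf_norm_bnd F.
  have [bFr bFi] := cbnd_parts bF.
  have /in_L0infP[[mr _ _] [mi _ _]] := in_L0inf_repr F.
  apply: le_trans (normc_le _) _; rewrite mulrDl /E/=; apply: lerD.
    by apply: Lbnd => k; rewrite mulrC; exact: avgW.
  by apply: Lbnd => k; rewrite mulrC; exact: avgW.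
pose Ed := Dual Ein; exists Ed => m.
suff act F : dual_act Ed F = F by apply: dual_ext => F; rewrite arensE act.
have lF := in_L0inf_repr F; have /in_L0infP[lr li] := lF.
rewrite -[RHS]cls_repr; apply: (dual_act_eq lF) => a a0.
have la := rL1_step w a; have lFa := in_L0inf_translate lF la.
have /in_L0infP[hr hi] := in_L0inf_repr (cls (repr F *c step a)).
(* The class [v] is that of the product of [u] with [step a]. Replacing it by the continuous
   [window a u] makes the averages converge to the value at 0, the integral of [u] over [[0, a]]. *)
have value u v : rL0 u -> rL0 v ->
    (\forall x \ae mu, 0 <= x -> v x = tr u (step a) x) ->
    L (avg v) = \int[mu]_(x in `[0, a]) u x.
  move=> lu lv vu; have lt := rL0_tr lu la.
  rewrite (Lext _ _ lv lt vu).
  have lG := rL0_window a0 lu.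
  rewrite (Lext _ _ lt lG); last first.
    by apply: aeW => x x0; exact: (tr_window a0 lu x0).
  rewrite (Llim _ _ (avg_cvg (rL0_locint lG) (continuous_window (a := a) lu))).
  by rewrite /window add0r set_itv1 Rintegral_set1 subr0.
have e := repr_cls lFa.
rewrite -[LHS]/(E _) /E; congr (_ +i* _); apply: value => //.
  by apply: filterS e => x h x0; rewrite h// translate_integralE.
by apply: filterS e => x h x0; rewrite h// translate_integralE.
Qed.

End right_identity.

(** * The right annihilator and derivations *)

Section annihilator.
Context {R : realType} (w : weight R).
Notation chi := (@chi R w).
Implicit Types (m n r : dual w) (theta D : dual w -> dual w).

#[local] Opaque L0inf_class translate_integral dual_act arens.

Lemma chi0 s : chi s 0 = 0.
Proof. by []. Qed.

Lemma ran0 : ran w 0.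
Proof. by apply: ran_chi => s _; rewrite chi0. Qed.

Lemma arensr0 m : arens m 0 = 0.
Proof. exact: ran0. Qed.

Lemma arens0r m : arens 0 m = 0.
Proof. by apply: dual_ext => F; rewrite arensE. Qed.

Lemma ran_square_zero n : arens n n = 0 -> ran w n.
Proof.
move=> nn; apply: ran_chi => s s0.
have := chi_arens n n s0; rewrite nn chi0 => /esym/eqP.
by rewrite mulf_eq0 orbb => /eqP.
Qed.

(** Some [chi t p] is nonzero, idempotence carries this to every [s], and multiplicativity leaves
    [chi s n = 0]. *)
Lemma ran_idempotent_mul p n : arens p p = p -> ~ ran w p ->
  arens p n = 0 -> ran w n.
Proof.
move=> pp np pn.
have [t t0 chit] : exists2 t, 0 < t & chi t p != 0.
  apply: contrapT => H; apply: np; apply: ran_chi => s s0.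
  by apply/eqP; apply: contrapT => /negP h; apply: H; exists s.
apply: ran_chi => s s0; have := chi_arens p n s0.
rewrite pn chi0 (chi_idempotent pp s0 t0) => /esym/eqP.
by rewrite mulf_eq0 (negbTE chit) => /eqP.
Qed.

Lemma homomorphism0 theta : homomorphism theta -> theta 0 = 0.
Proof.
move=> [lin _]; have := lin (-1) 0 0.
by rewrite scaleN1r oppr0 addr0 scaleN1r addNr.
Qed.

Lemma homomorphism_ran theta r : homomorphism theta -> ran w r -> ran w (theta r).
Proof.
move=> hom rr; have [_ mult] := hom; apply: ran_square_zero.
by rewrite -mult rr homomorphism0.
Qed.

Lemma derivation0 S theta D : S 0 -> theta_derivation_on S theta D -> D 0 = 0.
Proof.
move=> S0 [_ lin _]; have := lin (-1) 0 0 S0 S0.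
by rewrite scaleN1r oppr0 addr0 scaleN1r addNr.
Qed.

Lemma derivation_ran theta D r : homomorphism theta ->
  theta_derivation_on setT theta D -> ran w r -> ran w (D r).
Proof.
move=> hom der rr; have [_ mult] := hom; have [_ _ leib] := der.
have [E rightE] := right_identity w.
pose p := theta E; have pp : arens p p = p by rewrite -mult rightE.
have [rp|np] := pselect (ran w p).
  have theta0 m : theta m = 0 by rewrite -(rightE m) mult; exact: rp.
  have -> : D r = 0; last exact: ran0.
  by rewrite -(rightE r) leib// !theta0 arensr0 arens0r addr0.
apply: (ran_idempotent_mul pp np).
have := leib E r I I; rewrite rr (derivation0 _ der)//.
by rewrite (homomorphism_ran hom rr) add0r.
Qed.

Lemma dual_norm0 : dual_norm (0 : dual w) = 0.
Proof.
rewrite /dual_norm.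
have sub : [set normc ((0 : dual w) F) | F in [set F | L0inf_norm F <= 1]]
    `<=` [set 0] by move=> _ [F _ <-]; exact: normc0.
have [->|/set0P ne] := eqVneq
  [set normc ((0 : dual w) F) | F in [set F | L0inf_norm F <= 1]] set0.
  exact: sup0.
suff -> : [set normc ((0 : dual w) F) | F in [set F | L0inf_norm F <= 1]] = [set 0].
  exact: sup1.
apply/seteqP; split => // _ ->; have [_ [F FA _]] := ne.
by exists F => //; exact: normc0.
Qed.

Lemma spectral_radius_ran r : ran w r -> spectral_radius r = 0.
Proof.
move=> rr; rewrite /spectral_radius; apply/cvg_lim => //.
(* Index [k] stands for the power [k.+1]: the term at 0 is the norm of [r] itself, and every later
   term vanishes. *)
apply: cvg_near_cst; exists 1%N => // -[//|k] _.
have -> : iter k.+1 (arens r) r = 0.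
  elim: k => [|k IH]; first exact: rr.
  by rewrite iterS IH arensr0.
by rewrite dual_norm0 powR0// gt_eqF// invr_gt0.
Qed.

End annihilator.

Theorem corollary2p2 (R : realType) (w : weight R) (theta : dual w -> dual w)
    (theta_hom : homomorphism theta) :
  (forall D1 D2 : dual w -> dual w,
      theta_derivation_on setT theta D1 ->
      theta_derivation_on setT theta D2 ->
      theta_derivation_on (ran w) theta (D1 \o D2)) /\
  (forall D : dual w -> dual w,
      theta_derivation_on (ran w) theta D ->
      spectrally_bounded_on (ran w) D).
Proof.
split=> [D1 D2 der1 der2|D [Dran _ _]].
  have [_ lin1 _] := der1; have [_ lin2 _] := der2.
  have ran2 r (rr : ran w r) := derivation_ran theta_hom der2 rr.
  have ran1 r (rr : ran w r) := derivation_ran theta_hom der1 rr.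
  split => [r /ran2/ran1//|a m n _ _|m n rm rn].
    by rewrite /= lin2// lin1.
  (* The product [arens m n] is 0, so the left side is an image of 0; on the right, [theta n] and
     [D1 (D2 n)] lie in the annihilator and both products vanish. *)
  rewrite /= (rn m) (derivation0 _ der2)// (derivation0 _ der1)//.
  have -> := homomorphism_ran theta_hom rn (D1 (D2 m)).
  by have -> := ran1 _ (ran2 _ rn) (theta m); rewrite addr0.
(* The values of [D] stay in the annihilator, whose elements have spectral radius 0. *)
exists 0 => // r /Dran Dr.
by rewrite (spectral_radius_ran Dr) mul0r.
Qed.
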